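(* Every nice graph is algebraic $(1,6)$-choosable.
   Context: All graphs are finite and simple, with vertex set $V=\{1,\dots,n\}$; an edge is a $2$-element subset $\{i,j\}$ of $V$. For $i\in V$, $E(i)$ is the set of edges incident to $i$. An edge $\{i,j\}$ is isolated if both $i$ and $j$ have degree $1$; a graph is nice if it has no isolated edges. For a graph $G=(V,E)$ define the polynomial in variables $x_e$ ($e\in E$) $$P_G=\prod_{\{i,j\}\in E,\ i<j}\Big(\sum_{e\in E(i)}x_e-\sum_{e\in E(j)}x_e\Big)$$ (the empty product is $1$). For $K:E\to\mathbb{N}$ write $x^K=\prod_{e\in E}x_e^{K(e)}$, and let $\mathrm{mon}(P)$ be the set of monomials $x^K$ with nonzero coefficient in $P$. For a positive integer $b$, $G$ is algebraic $(1,b)$-choosable if there is $K:E\to\mathbb{N}$ with $\sum_{e\in E}K(e)=|E|$ and $K(e)\le b-1$ for all $e\in E$ such that $x^K\in\mathrm{mon}(P_G)$. *)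

(* Defs.v *)
From HB Require Import structures.
From mathcomp Require Import all_boot all_order all_algebra.
From mathcomp Require Import mpoly.
Set Implicit Arguments. Unset Strict Implicit. Unset Printing Implicit Defensive.
Import Order.TTheory GRing.Theory Num.Theory.
Local Open Scope ring_scope.

(* A simple graph on the vertex set 'I_n = {0,...,n-1} with m edges is given
   by an edge labelling  ends : 'I_m -> 'I_n * 'I_n  where edge e is the
   2-element set {(ends e).1, (ends e).2}; we require (ends e).1 < (ends e).2
   (so edges are genuine 2-subsets, listed with smaller endpoint first) and
   ends injective (no repeated edges).  The variables x_e are 'X_e, e : 'I_m. *)

Definition simple_graph (n m : nat) (ends : 'I_m -> 'I_n * 'I_n) : Prop :=
  injective ends /\ forall e : 'I_m, ((ends e).1 < (ends e).2)%N.

Definition incident (n m : nat) (ends : 'I_m -> 'I_n * 'I_n) (i : 'I_n) (e : 'I_m) : bool :=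
  ((ends e).1 == i) || ((ends e).2 == i).

Definition vdeg (n m : nat) (ends : 'I_m -> 'I_n * 'I_n) (i : 'I_n) : nat :=
  #|[set e : 'I_m | incident ends i e]|.

Definition nice (n m : nat) (ends : 'I_m -> 'I_n * 'I_n) : Prop :=
  forall e : 'I_m, ~ (vdeg ends (ends e).1 = 1%N /\ vdeg ends (ends e).2 = 1%N).

Definition vsum (n m : nat) (ends : 'I_m -> 'I_n * 'I_n) (i : 'I_n) : {mpoly int[m]} :=
  \sum_(f : 'I_m | incident ends i f) 'X_f.

Definition PG (n m : nat) (ends : 'I_m -> 'I_n * 'I_n) : {mpoly int[m]} :=
  \prod_(e : 'I_m) (vsum ends (ends e).1 - vsum ends (ends e).2).

Definition alg_choosable_1b (n m : nat) (ends : 'I_m -> 'I_n * 'I_n) (b : nat) : Prop :=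
  exists K : 'X_{1..m},
    [/\ mdeg K = m,
        (forall e : 'I_m, (K e <= b.-1)%N)
      & K \in msupp (PG ends)].

(* Main.v *)
Require Import Defs.
From mathcomp Require Import all_boot all_order all_algebra.
From mathcomp Require Import mpoly zify ring.
Set Implicit Arguments. Unset Strict Implicit. Unset Printing Implicit Defensive.
Import Order.TTheory GRing.Theory Num.Theory.
Local Open Scope ring_scope.

(** Let [Q] be the product of the [x_u - x_v] over the edges [uv], in vertex
    variables.  The coefficient of [x^K] in [P_G] is, up to the factor [K!], the
    value at [Q] of the product of the operators [(d_u + d_v)^K(uv)], that is, the
    permanent of a matrix whose rows and columns are indexed by edges.  So it
    suffices to find [m] combinations of edge operators with nonzero permanent
    such that every edge occurs in at most five of them.

    We work in one connected component.  Let [A] be a maximum independent set and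
    [B] its complement.  If the operators for the rows between [A] and [B] involve
    only vertices of [A], the permanent splits into a factor for those rows and a
    factor for the rows inside [B].

    Inside [B] (Wong and Zhu), vertices are added one at a time.  A new vertex [v]
    with [d] earlier neighbours brings [d] columns [v], each of which is rewritten
    as the edge [uv] minus the vertex [u].  Every vertex column is used at most
    once, every edge at most twice, and a leftover vertex column [b] is replaced by
    an edge from [b] to [A].

    For the rows between [A] and [B], the neighbours of each [b] in [A] are
    matched, and a matched pair [a, a'] contributes the square of
    [ba - ba' = d_a - d_a'].  The neighbours left over are matched along
    edge-disjoint paths of a spanning tree, which contribute the squares of forms
    [d_a + d_a'] or [d_a - d_a'].  The factor is then, up to a nonzero constant, the
    coefficient of the product of all [x_a x_a'] in [G^2], where [G] is the product
    of the forms.  Exchanging [a] and [a'] in every form changes [G] by a sign only,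
    so that coefficient is, up to sign, the sum of the squares of the coefficients of
    [G].  If all vertices of a set of at least two have the same single neighbour
    [a] in [A], maximality makes this set a clique, and triangles yield [2 d_a]
    directly. *)

(** * Permanents: symmetry, multilinearity and block factorisation *)

Section Permanent.
Variables (I : finType) (T : eqType) (R : comNzRingType) (c : T -> I -> R).
Implicit Types (x y z : T) (xs ys ts : seq T) (S : {set I}).

(* The permanent of the matrix with rows [S] and columns [ts], expanded along the
   columns; it is [0] when there are not as many columns as rows. *)
Fixpoint pm ts S : R :=
  if ts is x :: ts' then \sum_(i in S) c x i * pm ts' (S :\ i)
  else (S == set0)%:R.

Lemma pm_size ts S : pm ts S != 0 -> size ts = #|S|.
Proof.
elim: ts S => [|x ts IH] S /=.
  by case: (S =P set0) => [->|_]; rewrite ?cards0 // eqxx.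
move=> nz; have [i iS nzi] : exists2 i, i \in S & pm ts (S :\ i) != 0.
  apply/exists_inP; apply: contraR nz; rewrite negb_exists_in => /forall_inP z.
  by rewrite big1 // => i /z; rewrite negbK => /eqP ->; rewrite mulr0.
by rewrite (IH _ nzi) (cardsD1 i S) iS.
Qed.

Lemma pm_swap x y ts S : pm (x :: y :: ts) S = pm (y :: x :: ts) S.
Proof.
rewrite /=.
under eq_bigr do rewrite big_distrr /=.
under [RHS]eq_bigr do rewrite big_distrr /=.
rewrite (exchange_big_dep (mem S)) /=; last by move=> i j _ /setD1P[].
apply: eq_bigr => j jS; apply: eq_big => [i|i /andP[iS _]].
  by rewrite !inE jS andbT andbC eq_sym.
by rewrite mulrCA !setDDl setUC.
Qed.

Lemma pm_cons2 x ts ts' :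
  (forall S, pm ts S = pm ts' S) -> forall S, pm (x :: ts) S = pm (x :: ts') S.
Proof. by move=> e S /=; apply: eq_bigr => i _; rewrite e. Qed.

Lemma pm_move x ts1 ts2 S : pm (ts1 ++ x :: ts2) S = pm (x :: ts1 ++ ts2) S.
Proof.
elim: ts1 S => [//|y ts1 IH] S.
by rewrite cat_cons (pm_cons2 _ IH) pm_swap.
Qed.

Lemma pm_perm ts ts' S : perm_eq ts ts' -> pm ts S = pm ts' S.
Proof.
elim: ts ts' S => [|x ts IH] ts' S p.
  by move: p; rewrite perm_sym => /perm_nilP ->.
have xts' : x \in ts' by rewrite -(perm_mem p) mem_head.
have [t1 [t2 e]] : exists t1 t2, ts' = t1 ++ x :: t2.
  by case/splitPr: xts' => t1 t2; exists t1, t2.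
rewrite e pm_move; apply: pm_cons2 => S'; apply: IH.
by move: p; rewrite e perm_sym perm_catC cat_cons perm_cons perm_catC perm_sym.
Qed.

Lemma pm_sum (J : Type) (r : seq J) (a : J -> R) (f : J -> T) x ts S :
  (forall i, i \in S -> c x i = \sum_(j <- r) a j * c (f j) i) ->
  pm (x :: ts) S = \sum_(j <- r) a j * pm (f j :: ts) S.
Proof.
move=> h /=; under [RHS]eq_bigr do rewrite big_distrr /=.
rewrite exchange_big /=; apply: eq_bigr => i iS.
by rewrite h // big_distrl /=; apply: eq_bigr => j _; rewrite mulrA.
Qed.

Lemma pmD x y z ts S :
  (forall i, i \in S -> c x i = c y i + c z i) ->
  pm (x :: ts) S = pm (y :: ts) S + pm (z :: ts) S.
Proof.
move=> h /=; rewrite -big_split; apply: eq_bigr => i iS /=.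
by rewrite h // mulrDl.
Qed.

(** The columns [xs] can only be matched to rows in [Rw] and fill [Rw] exactly, so [ts] is left with
    the complement. *)
Lemma pm_block (Rw : {set I}) xs ts S :
  Rw \subset S -> size xs = #|Rw| ->
  (forall x i, x \in xs -> i \in S -> i \notin Rw -> c x i = 0) ->
  pm (xs ++ ts) S = pm xs Rw * pm ts (S :\: Rw).
Proof.
elim: xs Rw S => [|x xs IH] Rw S sRS /= sz van.
  by move/esym/eqP: sz; rewrite cards_eq0 => /eqP ->; rewrite eqxx mul1r setD0.
rewrite big_distrl /= (big_setID Rw) /= [X in _ + X]big1 ?addr0; last first.
  by move=> i /setDP[iS iR]; rewrite van ?mem_head // mul0r.
rewrite (setIidPr sRS); apply: eq_bigr => i iR; rewrite -mulrA; congr (_ * _).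
rewrite (IH (Rw :\ i)).
- congr (_ * pm _ _); apply/setP=> j; rewrite !inE; case: eqVneq => [->|]; rewrite ?iR //.
- exact: setSD.
- by move: sz; rewrite (cardsD1 i) iR => -[].
- move=> y j yxs /setD1P[ji jS] jR; apply: van => //; first by rewrite inE yxs orbT.
  by apply: contra jR => jR; rewrite !inE ji.
Qed.

(** Pigeonhole: the columns [xs] can only be matched to rows of [S] in [Rw], which are too few. *)
Lemma pm_excess (Rw : {set I}) xs ts S :
  (#|S :&: Rw| < size xs)%N ->
  (forall x i, x \in xs -> i \in S -> i \notin Rw -> c x i = 0) ->
  pm (xs ++ ts) S = 0.
Proof.
elim: xs S => [//|x xs IH] S /= sz van; apply: big1 => i iS.
have [iR|iR] := boolP (i \in Rw); last by rewrite van ?mem_head // mul0r.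
rewrite IH ?mulr0 //; last first.
  by move=> y j yxs /setD1P[ji jS] jR; apply: van => //; rewrite inE yxs orbT.
move: sz; rewrite (cardsD1 i) inE iS iR /= add1n ltnS; apply: leq_trans.
by rewrite ltnS subset_leq_card //; apply/subsetP=> j; rewrite !inE => /andP[/andP[-> ->] ->].
Qed.

Lemma pm_nseq x S :
  pm (nseq #|S| x) S = (#|S|)`!%:R * \prod_(i in S) c x i.
Proof.
move sz : #|S| => d; elim: d S sz => [|d IH] S sz.
  have /eqP -> : S == set0 by rewrite -cards_eq0 sz.
  by rewrite /= eqxx big_set0 mulr1.
transitivity (\sum_(i in S) (d`!%:R * \prod_(i in S) c x i) : R).
  apply: eq_bigr => i iS; have sz' : #|S :\ i| = d.
    by move: sz; rewrite (cardsD1 i) iS => -[].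
  rewrite -/(pm (nseq d x) _) IH // [in RHS](bigD1 i iS) /= mulrCA; congr (_ * (_ * _)).
  by apply: eq_bigl => j; rewrite !inE andbC.
by rewrite sumr_const sz factS natrM -mulrA !mulr_natl.
Qed.

End Permanent.

Lemma eq_pm_map (I : finType) (T T' U : eqType) (R : comNzRingType)
    (c : T -> I -> R) (c' : T' -> I -> R) (f : U -> T) (g : U -> T') us (S : {set I}) :
  (forall u i, u \in us -> i \in S -> c (f u) i = c' (g u) i) ->
  pm c (map f us) S = pm c' (map g us) S.
Proof.
elim: us S => [//|u us IH] S h /=; apply: eq_bigr => i iS.
rewrite h ?mem_head //; congr (_ * _); apply: IH => v j vus /setD1P[_ jS].
by apply: h => //; rewrite inE vus orbT.
Qed.

(** * From coefficients of [PG] to permanents *)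

Section Columns.
Variables (n m : nat) (ends : 'I_m -> 'I_n * 'I_n).

Definition vx (v : 'I_n) : {ffun 'I_n -> int} := [ffun u => (u == v)%:R].
Definition eb (e : 'I_m) : {ffun 'I_n -> int} := vx (ends e).1 + vx (ends e).2.
(* For [y = eb e] this is the coefficient of [x_e] in the factor of [PG] at edge [i]. *)
Definition ecol (y : {ffun 'I_n -> int}) (i : 'I_m) : int :=
  y (ends i).1 - y (ends i).2.
(** The unsigned incidence map: the vertex vector represented by an integer combination of edge
    operators. *)
Definition bd (M : {ffun 'I_m -> int}) : {ffun 'I_n -> int} :=
  \sum_e eb e *~ M e.

Lemma ecolD y z i : ecol (y + z) i = ecol y i + ecol z i.
Proof. by rewrite /ecol !ffunE; ring. Qed.

Lemma bdD M N : bd (M + N) = bd M + bd N.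
Proof. by rewrite /bd -big_split; apply: eq_bigr => e _; rewrite ffunE mulrzDr. Qed.

Lemma bdN M : bd (- M) = - bd M.
Proof. by rewrite /bd -sumrN; apply: eq_bigr => e _; rewrite ffunE mulrNz. Qed.

Lemma bdB M N : bd (M - N) = bd M - bd N.
Proof. by rewrite bdD bdN. Qed.

Lemma bdMz M k : bd (M *~ k) = bd M *~ k.
Proof.
rewrite /bd mulrz_suml; apply: eq_bigr => e _.
by rewrite -mulrzA ffunMzE mulrzz.
Qed.

Lemma ecol_bd M i : ecol (bd M) i = \sum_e M e * ecol (eb e) i.
Proof.
rewrite /ecol /bd !sum_ffunE -sumrB; apply: eq_bigr => e _.
by rewrite !ffunMzE !mulrzz; ring.
Qed.

Definition deriv_seq (es : seq 'I_m) (p : {mpoly int[m]}) := foldl (fun q e => q^`M(e)) p es.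

Lemma deriv_seq_sum (es : seq 'I_m) (S : {set 'I_m}) (a : 'I_m -> int) (p : 'I_m -> {mpoly int[m]}) :
  deriv_seq es (\sum_(i in S) a i *: p i) = \sum_(i in S) a i *: deriv_seq es (p i).
Proof.
elim: es p => [//|e es IH] p; rewrite /= -IH; congr deriv_seq.
by rewrite raddf_sum; apply: eq_bigr => i _ /=; rewrite mderivZ.
Qed.

(** The value of the factor [c] does not matter: a nonzero coefficient after differentiation forces
    a nonzero one before it. *)
Lemma deriv_seq_coef (es : seq 'I_m) (p : {mpoly int[m]}) k :
  exists c : nat, (deriv_seq es p)@_k = p@_(k + \sum_(e <- es) U_(e))%MM *+ c.
Proof.
elim: es p k => [|e es IH] p k; first by exists 1%N; rewrite big_nil Monoid.mulm1.
case: (IH (p^`M(e)) k) => c /= ->; rewrite mcoeff_deriv -mulrnA.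
by exists (((k + \sum_(i <- es) U_(i))%MM e).+1 * c)%N; rewrite big_cons (addmC U_(e)%MM) addmA.
Qed.

Lemma mderiv_vsum e v : (vsum ends v)^`M(e) = (incident ends v e)%:R%:MP.
Proof.
rewrite /vsum raddf_sum /= (bigID (pred1 e)) /= [X in _ + X]big1 ?addr0.
  have [ie|ie] := boolP (incident ends v e).
    rewrite (big_pred1 e) => [|j]; last by rewrite /= andbC; case: eqP => [->|].
    by rewrite mderivX mnm1E eqxx scale1r -[X in (X - _)%MM]add0m addmK mpolyX0.
  by rewrite big_pred0 // => j; case: (j =P e) => [->|]; rewrite ?andbF // (negPf ie).
by move=> j /andP[_ je]; rewrite mderivX mnm1E (negPf je) scale0r.
Qed.

Lemma eb_incident e v : (ends e).1 != (ends e).2 -> eb e v = (incident ends v e)%:R.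
Proof.
rewrite /eb /incident !ffunE ![v == _]eq_sym.
by case: (_ =P v) => [->|_]; case: (_ =P v) => // ->; rewrite eqxx.
Qed.

Hypothesis simple : simple_graph ends.

Lemma ends_neq e : (ends e).1 != (ends e).2.
Proof. by case: simple => _ /(_ e); rewrite ltn_neqAle => /andP[]. Qed.

(** Every factor is linear, so by the Leibniz rule each derivative removes one factor and leaves its
    coefficient at [x_e]; this is the column expansion of [pm]. *)
Lemma deriv_seq_prod (es : seq 'I_m) (S : {set 'I_m}) : size es = #|S| ->
  deriv_seq es (\prod_(i in S) (vsum ends (ends i).1 - vsum ends (ends i).2))
    = (pm ecol (map eb es) S)%:MP.
Proof.
elim: es S => [|e es IH] S /= sz.
  have /eqP -> : S == set0 by rewrite -cards_eq0 -sz.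
  by rewrite big_set0 eqxx.
set f := fun i => vsum ends (ends i).1 - vsum ends (ends i).2.
have -> : (\prod_(i in S) f i)^`M(e) =
   \sum_(i in S) ecol (eb e) i *: \prod_(j in S :\ i) f j.
  have gen : forall (s : seq 'I_m), uniq s -> (\prod_(i <- s) f i)^`M(e) =
      \sum_(i <- s) ecol (eb e) i *: \prod_(j <- s | j != i) f j.
    elim=> [|j s IHs] /=; first by rewrite !big_nil mderivC.
    case/andP=> js us; rewrite !big_cons eqxx /= mderivM IHs //; congr (_ + _).
      rewrite /f mderivB !mderiv_vsum -mpolyCB mul_mpolyC; congr (_ *: _).
        by rewrite /ecol !eb_incident // ends_neq.
      by rewrite big_seq [RHS]big_seq_cond; apply: eq_bigl => i; case: (i =P j) => [->|]; rewrite ?(negPf js) ?andbT.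
    rewrite mulr_sumr big_seq [RHS]big_seq; apply: eq_bigr => i iis.
    rewrite big_cons -scalerAr; case: (j =P i) => [ji|//].
    by rewrite ji iis in js.
  rewrite -big_enum gen ?enum_uniq // big_enum /=; apply: eq_bigr => i iS.
  congr (_ *: _); rewrite big_enum_cond /=; apply: eq_bigl => j.
  by rewrite !inE andbC.
rewrite deriv_seq_sum raddf_sum /=; apply: eq_bigr => i iS.
rewrite IH; last by move: sz; rewrite (cardsD1 i) iS => -[].
by rewrite mpolyCM mul_mpolyC.
Qed.

Lemma pm_choosable (es : seq 'I_m) b : (forall e, (count_mem e es <= b.-1)%N) ->
  pm ecol (map eb es) setT != 0 -> alg_choosable_1b ends b.
Proof.
move=> cb nz; have sz := pm_size nz; rewrite size_map in sz.
exists (\sum_(e <- es) U_(e))%MM; split.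
- rewrite mdeg_sum (eq_bigr (fun=> 1%N)) => [|e _]; last exact: mdeg1.
  by rewrite sum1_size sz cardsT card_ord.
- move=> e; apply: leq_trans (cb e); rewrite mnm_sumE -sum1_count [leqRHS]big_mkcond /=.
  by apply: leq_sum => f _; rewrite mnm1E eq_sym; case: eqP.
- rewrite mcoeff_msupp; apply: contraNneq nz => z.
  have := deriv_seq_prod sz; have -> : \prod_(i in [set: 'I_m]) (vsum ends (ends i).1 - vsum ends (ends i).2) = PG ends.
    by apply: eq_bigl => i; rewrite inE.
  move=> E; have [c] := deriv_seq_coef es (PG ends) 0%MM.
  by rewrite E add0m z mul0rn mcoeffC eqxx mulr1 => /eqP.
Qed.

Definition usage (Ms : seq {ffun 'I_m -> int}) (e : 'I_m) :=
  count (fun M : {ffun 'I_m -> int} => M e != 0) Ms.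

(** By multilinearity, one edge can be chosen from the support of each form so that the permanent
    stays nonzero. *)
Lemma pm_expand es0 (Ms : seq {ffun 'I_m -> int}) S :
  pm ecol (map eb es0 ++ map bd Ms) S != 0 ->
  exists2 es, pm ecol (map eb (es ++ es0)) S != 0 &
    forall e, (count_mem e es <= usage Ms e)%N.
Proof.
elim: Ms es0 => [|M Ms IH] es0 /=.
  by rewrite cats0 => nz; exists [::].
rewrite pm_move (pm_sum (r := index_enum _) (a := M) (f := eb)) => [nz|i _]; last exact: ecol_bd.
have [e eM ] : exists2 e, M e != 0 & pm ecol (eb e :: map eb es0 ++ map bd Ms) S != 0.
  apply/exists_inP; apply: contraR nz; rewrite negb_exists_in => /forall_inP z.
  rewrite big1 // => e _; have [->|/z] := eqVneq (M e) 0; first by rewrite mul0r.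
  by rewrite negbK => /eqP ->; rewrite mulr0.
rewrite -cat_cons -map_cons => /IH [es nz' le]; exists (rcons es e).
  by rewrite cat_rcons.
move=> f; rewrite -cats1 count_cat /= addn0 addnC leq_add //.
by case: eqP => // <-; rewrite eM.
Qed.

Lemma choosable_of_forms (Ms : seq {ffun 'I_m -> int}) b :
  (forall e, (usage Ms e <= b.-1)%N) -> pm ecol (map bd Ms) setT != 0 ->
  alg_choosable_1b ends b.
Proof.
move=> us /(@pm_expand [::])[es nz le]; rewrite cats0 in nz.
by apply: pm_choosable nz => e; apply: leq_trans (us e).
Qed.

End Columns.

Ltac mnm_lia := by apply/mnmP => ?; rewrite !mnmDE; lia.

(** * A nonvanishing coefficient in the square of a product of binomials *)

Section ConstantTerm.
Variable n : nat.
Implicit Types (p : 'I_n * 'I_n * int) (ps : seq ('I_n * 'I_n * int)).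

Definition binom p : {mpoly int[n]} := 'X_(p.1.1) + p.2 *: 'X_(p.1.2).
Definition mpair p : 'X_{1..n} := (U_(p.1.1) + U_(p.1.2))%MM.
(** The second condition excludes [x_a - x_a], the only zero binomial whose coefficient is a
    sign. *)
Definition good p := (p.2 ^+ 2 == 1) && ((p.1.1 != p.1.2) || (p.2 == 1)).
Definition bprod ps := \prod_(p <- ps) binom p.
Definition btarget ps : 'X_{1..n} := (\sum_(p <- ps) mpair p)%MM.

(** A term of the expansion takes one variable from each factor. An entry of [r] carries its
    coefficient, its monomial and the monomial of the variables not taken. Exchanging the variables
    of a factor multiplies it by its sign, as the sign has square [1]. *)
Lemma bprod_expand ps : all good ps ->
  exists r : seq (int * 'X_{1..n} * 'X_{1..n}),
  [/\ forall x, x \in r -> (x.1.2 + x.2)%MM = btarget ps,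
      bprod ps = \sum_(x <- r) x.1.1 *: 'X_[x.1.2] &
      (\prod_(p <- ps) p.2) *: bprod ps = \sum_(x <- r) x.1.1 *: 'X_[x.2]].
Proof.
elim: ps => [|[[a a'] e] ps IH] /=.
  move=> _; exists [:: (1, 0%MM, 0%MM)]; rewrite /bprod /btarget !big_nil !big_seq1 /= mpolyX0 scale1r.
  by split=> // x; rewrite inE => /eqP -> /=; rewrite addm0.
case/andP=> /andP[/eqP /= e2 _] /IH [r [rT r1 r2]].
exists ([seq (x.1.1, (U_(a) + x.1.2)%MM, (U_(a') + x.2)%MM) | x <- r] ++
        [seq (e * x.1.1, (U_(a') + x.1.2)%MM, (U_(a) + x.2)%MM) | x <- r]).
rewrite /bprod /btarget !big_cons /= -/(bprod ps) -/(btarget ps); split.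
- move=> x; rewrite mem_cat => /orP[] /mapP[y /rT <- ->] /=; rewrite /mpair /=; mnm_lia.
- rewrite big_cat !big_map /binom /= r1 mulrDl; congr (_ + _).
    by rewrite mulr_sumr; apply: eq_bigr => x _; rewrite mpolyXD -scalerAr.
  by rewrite mulr_sumr; apply: eq_bigr => x _; rewrite mpolyXD -!scalerAr -scalerAl scalerA mulrC.
- rewrite big_cat !big_map /binom /= -scalerA [(\prod_(_ <- _) _) *: _]scalerAr r2 mulrDl addrC scalerDr; congr (_ + _).
    rewrite mulr_sumr scaler_sumr; apply: eq_bigr => x _.
    by rewrite mpolyXD -scalerAr scalerA.
  rewrite -scalerAl scalerA -expr2 e2 scale1r.
  by rewrite mulr_sumr; apply: eq_bigr => x _; rewrite mpolyXD -scalerAr.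
Qed.

(* Exchanging the two variables of every factor multiplies the product by the signs. *)
Lemma bprod_rev ps K L : all good ps -> (K + L)%MM = btarget ps ->
  (bprod ps)@_K = (\prod_(p <- ps) p.2) * (bprod ps)@_L.
Proof.
case/bprod_expand=> r [rT r1 r2] KL.
rewrite -mcoeffZ r2 r1 !raddf_sum /= big_seq [RHS]big_seq.
apply: eq_bigr => x /rT; rewrite -KL !mcoeffZ !mcoeffX => E; congr (_ * (_ : bool)%:R).
apply/eqP/eqP=> [xK|xL]; first by move: E; rewrite xK => /addmI.
by move: E; rewrite xL => /addIm.
Qed.

Lemma binom_neq0 p : good p -> binom p != 0.
Proof.
case: p => [[a a'] e] /andP[/= /eqP e2 ne].
apply/eqP => /(congr1 (mcoeff U_(a)%MM)).
rewrite mcoeff0 /binom /= mcoeffD mcoeffZ !mcoeffX eqxx.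
have -> : (U_(a')%MM == U_(a)%MM :> 'X_{1..n}) = (a' == a).
  by apply/eqP/eqP => [/(congr1 (fun k : 'X_{1..n} => k a'))|->//]; rewrite !mnm1E eqxx; case: eqP.
by case: (eqVneq a' a) ne => [_ /= /eqP ->|_ _]; rewrite ?mulr0.
Qed.

(** By [bprod_rev], the convolution over [K + L = btarget ps] is a sign times a sum of integer
    squares, one of which is nonzero. *)
Lemma bprod_sqr ps : all good ps -> (bprod ps ^+ 2)@_(btarget ps) != 0.
Proof.
move=> gd; set G := bprod ps; set T := btarget ps.
have nzG : G != 0.
  by rewrite prodf_seq_neq0; apply/allP => p pp; rewrite binom_neq0 // (allP gd).
have [K KG] : exists K, K \in msupp G.
  move: nzG; rewrite -msupp_eq0; case: (msupp G) => // K s _; exists K; exact: mem_head.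
have [L KL] : exists L, (K + L)%MM = T.
  have [r [rT r1 _]] := bprod_expand gd; move: KG; rewrite mcoeff_msupp /G r1 raddf_sum /=.
  rewrite big_seq => nz; have [/hasP[x xr /eqP <-]|/hasPn no] := boolP (has (fun x => x.1.2 == K) r).
    by exists x.2; apply: rT.
  by move: nz; rewrite big1 ?eqxx // => x /no /negPf ne; rewrite mcoeffZ mcoeffX ne mulr0.
set s := \prod_(p <- ps) p.2.
have sT : mdeg T = (mdeg K + mdeg L)%N by rewrite -KL mdegD.
have bK : (mdeg K < (mdeg T).+1)%N by rewrite ltnS sT leq_addr.
have bL : (mdeg L < (mdeg T).+1)%N by rewrite ltnS sT leq_addl.
rewrite expr2 mcoeffM.
rewrite (eq_bigr (fun k : 'X_{1..n < (mdeg T).+1, (mdeg T).+1} => s * (G@_k.2) ^+ 2)); last first.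
  by move=> k /eqP kT; rewrite (bprod_rev (K := k.1) (L := k.2) gd) // mulrA.
rewrite -mulr_sumr mulf_neq0 //.
  rewrite prodf_seq_neq0; apply/allP => p /(allP gd) /andP[/eqP e _].
  by apply: contra_eq_neq e => ->; rewrite expr0n.
rewrite psumr_neq0 => [|k _]; last exact: sqr_ge0.
apply/hasP; exists (BMultinom bL, BMultinom bK); first exact: mem_index_enum.
by rewrite /= addmC KL eqxx /= lt_def sqr_ge0 sqrf_eq0 andbT -mcoeff_msupp.
Qed.

Lemma bprod_cat ps qs : bprod (ps ++ qs) = bprod ps * bprod qs.
Proof. by rewrite /bprod big_cat. Qed.

(* By symmetry, twice this coefficient is, up to sign, the one of [bprod_sqr] for [p :: ps]. *)
Lemma bprod_sqr_lin ps p : all good ps -> good p ->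
  (bprod ps ^+ 2 * binom p)@_(btarget ps + U_(p.1.1)) != 0.
Proof.
move=> gps gp; set H := bprod ps ^+ 2 * binom p.
have gpps : all good (p :: ps) by rewrite /= gp.
have := bprod_sqr gpps; apply: contraNneq => H0.
have e2 : p.2 ^+ 2 = 1 by case/andP: gp => /eqP.
have s2 : (\prod_(q <- ps) q.2) ^+ 2 = 1.
  rewrite -prodrXl big_seq big1 // => q /(allP gps) /andP[/eqP] //.
(* [H] is itself a product of good binomials, and reversal exchanges the exponents ending in [p.1.1]
   and [p.1.2], so both coefficients vanish. *)
have HE : H = bprod (ps ++ ps ++ [:: p]).
  by rewrite !bprod_cat /H expr2 mulrA /bprod big_seq1.
have gH : all good (ps ++ ps ++ [:: p]) by rewrite !all_cat gps /= gp.
have H1 : H@_(btarget ps + U_(p.1.2)) = 0.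
  rewrite HE (bprod_rev (L := (btarget ps + U_(p.1.1))%MM) gH) -?HE ?H0 ?mulr0 //.
  rewrite /btarget !big_cat /= big_seq1 /mpair; mnm_lia.
have -> : bprod (p :: ps) ^+ 2 = H * 'X_(p.1.1) + p.2 *: (H * 'X_(p.1.2)).
  rewrite /bprod big_cons -/(bprod ps) /H scalerAr -mulrDr -/(binom p); ring.
rewrite mcoeffD mcoeffZ /btarget big_cons -/(btarget ps) /mpair.
rewrite [X in _@_X + _](_ : _ = (U_(p.1.1) + (btarget ps + U_(p.1.2)))%MM); last mnm_lia.
rewrite mcoeffMX H1 add0r.
rewrite [X in _@_X](_ : _ = (U_(p.1.2) + (btarget ps + U_(p.1.1)))%MM) ?mcoeffMX ?H0 ?mulr0 //.
mnm_lia.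
Qed.

End ConstantTerm.

(** * Permanents in which each row reads a single coordinate *)

Section SignedBlock.
Variables (n : nat) (I : finType) (al : I -> 'I_n) (sg : I -> int).
Implicit Types (y : {ffun 'I_n -> int}).

Definition lin y : {mpoly int[n]} := \sum_v y v *: 'X_v.

Lemma mcoeffXM0 (q : {mpoly int[n]}) a (d : 'X_{1..n}) :
  d a = 0%N -> ('X_a * q)@_d = 0.
Proof.
move=> d0; apply/eqP; rewrite mcoeff_eq0 mulrC (perm_mem (msuppMX _ _)).
by apply/mapP => -[k _ E]; move: d0; rewrite E mnmDE mnm1E eqxx.
Qed.

(** A matching amounts to a choice of one variable from each form, with every [a] chosen [d a]
    times; the rows over [a] can then be permuted in [(d a)!] ways. *)
Lemma pm_signed (ys : seq {ffun 'I_n -> int}) (S : {set I}) :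
  size ys = #|S| ->
  let d := (\sum_(i in S) U_(al i))%MM in
  pm (fun y i => sg i * y (al i)) ys S =
  (\prod_(i in S) sg i) * (\prod_a (d a)`!)%:R * (\prod_(y <- ys) lin y)@_d.
Proof.
elim: ys S => [|y ys IH] S sz d /=.
  have /eqP S0 : S == set0 by rewrite -cards_eq0 -sz.
  rewrite /d S0 eqxx !big_set0 big_nil mcoeff1 eqxx mul1r mulr1 big1 // => a _.
  by rewrite mnm0E.
rewrite big_cons {2}/lin mulr_suml raddf_sum /= mulr_sumr.
set q := \prod_(y <- ys) lin y in IH *.
(* Group the rows by their vertex [a]: the [d a] equal terms turn [(d a - 1)!] into [(d a)!]. *)
rewrite (partition_big al predT) //=; apply: eq_bigr => a _.
rewrite -scalerAl mcoeffZ.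
have dE b : d b = #|[set i in S | al i == b]|.
  rewrite /d mnm_sumE -sum1dep_card [RHS]big_mkcondr /=.
  by apply: eq_bigr => i _; rewrite mnm1E; case: eqP.
have [d0|dn0] := eqVneq (d a) 0%N.
  rewrite mcoeffXM0 // !mulr0 big_pred0 // => i; apply/negbTE/negP => iP.
  by move/eqP: d0; rewrite dE cards_eq0 => /eqP/setP/(_ i); rewrite !inE iP.
pose d' := (d - U_(a))%MM.
have deriv_seq' : d = (U_(a) + d')%MM.
  rewrite /d' addmC submK //; apply/mnm_lepP => b; rewrite mnm1E.
  by case: eqP => [<-|//]; rewrite lt0n.
have Ei i : (i \in S) && (al i == a) -> sg i * y (al i) * pm (fun y i => sg i * y (al i)) ys (S :\ i)
   = (\prod_(i in S) sg i) * (\prod_a (d' a)`!)%:R * (y a * q@_d').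
  case/andP=> iS /eqP ia; rewrite IH; last by move: sz; rewrite (cardsD1 i) iS => -[].
  have -> : (\sum_(j in S :\ i) U_(al j))%MM = d'.
    have -> : d' = (U_(a) + \sum_(j in S :\ i) U_(al j) - U_(a))%MM.
      by rewrite /d' /d [in LHS](big_setD1 i) //= ia.
    by rewrite addmC addmK.
  rewrite [in RHS](big_setD1 i) //= ia; ring.
rewrite (eq_bigr _ Ei) sumr_const.
have -> : #|[pred i | (i \in S) && (al i == a)]| = d a.
  by rewrite dE cardsE.
have -> : ('X_a * q)@_d = q@_d' by rewrite mulrC deriv_seq' mcoeffMX.
rewrite [in RHS](bigD1 a) //= [in LHS](bigD1 a) //= -mulr_natl.
have -> : (d a)`! = (d a * (d' a)`!)%N.
  by rewrite /d' mnmBE mnm1E eqxx subn1; case: (d a) dn0 => // k _; rewrite factS.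
have -> : (\prod_(i < n | i != a) (d i)`!)%N = (\prod_(i < n | i != a) (d' i)`!)%N.
  by apply: eq_bigr => i ia; rewrite /d' mnmBE mnm1E eq_sym (negPf ia) subn0.
rewrite !natrM; ring.
Qed.

End SignedBlock.

Arguments pm : simpl never.

(** * Rows inside a vertex set: tokens and edges *)

Section Tokens.
Variables (n m : nat) (ends : 'I_m -> 'I_n * 'I_n).
Hypothesis simple : simple_graph ends.
Implicit Types (u v w : 'I_n) (e f : 'I_m) (X : {set 'I_n}).

Definition joins e u v :=
  ((ends e).1 == u) && ((ends e).2 == v) || ((ends e).1 == v) && ((ends e).2 == u).
Definition adj u v := [exists e, joins e u v].
Definition rows X := [set e | ((ends e).1 \in X) && ((ends e).2 \in X)].

Lemma joinsC e u v : joins e u v = joins e v u.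
Proof. by rewrite /joins orbC. Qed.

Lemma adjC u v : adj u v = adj v u.
Proof. by apply: eq_existsb => e; rewrite joinsC. Qed.

Lemma joins_neq e u v : joins e u v -> u != v.
Proof.
by have := ends_neq simple e; rewrite /joins => ne /orP[] /andP[/eqP <- /eqP <-]; rewrite // eq_sym.
Qed.

Lemma adj_neq u v : adj u v -> u != v.
Proof. by case/existsP=> e /joins_neq. Qed.

Lemma joins_inj e f u v : joins e u v -> joins f u v -> e = f.
Proof.
case: simple => inj lt; move: (lt e) (lt f); rewrite /joins => le lf.
case/orP=> /andP[/eqP a1 /eqP a2] /orP[] /andP[/eqP b1 /eqP b2]; apply: inj;
  rewrite [LHS]surjective_pairing [RHS]surjective_pairing a1 a2 b1 b2 //;
  by move: le lf; rewrite a1 a2 b1 b2; lia.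
Qed.

Lemma joins_eq e u v u' v' : joins e u v -> joins e u' v' ->
  (u = u' /\ v = v') \/ (u = v' /\ v = u').
Proof.
rewrite /joins.
by case/orP=> /andP[/eqP <- /eqP <-] /orP[] /andP[/eqP <- /eqP <-]; auto.
Qed.

Lemma joins_ends e : joins e (ends e).1 (ends e).2.
Proof. by rewrite /joins !eqxx. Qed.

Lemma eb_joins e u v : joins e u v -> eb ends e = vx u + vx v.
Proof. by rewrite /eb; case/orP=> /andP[/eqP -> /eqP ->] //; rewrite addrC. Qed.

Definition otherend e v := if (ends e).1 == v then (ends e).2 else (ends e).1.

Lemma joins_opp e v : incident ends v e -> joins e v (otherend e v).
Proof.
rewrite /otherend /joins; case/orP => /eqP <-; rewrite ?eqxx //.
by rewrite (negPf (ends_neq simple e)) !eqxx orbT.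
Qed.

Lemma joins_incident e u v : joins e u v -> incident ends u e.
Proof. by rewrite /incident; case/orP=> /andP[/eqP -> /eqP ->]; rewrite eqxx ?orbT. Qed.

Lemma joins_oppE e u v : joins e u v -> otherend e u = v.
Proof.
move=> j; have /joins_opp jo := joins_incident j.
by case: (joins_eq j jo) => [[_]|[E1 E2]] //; move: (joins_neq j); rewrite E2 eqxx.
Qed.

Lemma ecol_vx0 v i : ~~ incident ends v i -> ecol ends (vx v) i = 0.
Proof.
by rewrite negb_or /ecol !ffunE => /andP[/negPf -> /negPf ->].
Qed.

Lemma ecol_vx_neq0 v i : incident ends v i -> ecol ends (vx v) i != 0.
Proof.
have := ends_neq simple i; rewrite /incident /ecol !ffunE => ne /orP[] /eqP E.
  by move: ne; rewrite E eqxx eq_sym => /negPf ->.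
by move: ne; rewrite E eqxx => /negPf ->.
Qed.

Local Notation pmc := (pm (ecol ends)).

(** Replace one column at a time: on [S] the difference [f u - g u] is supported on [Rw], whose rows
    [xs] already fills, so [pm_excess] kills its contribution. *)
Lemma pm_shift (U : eqType) (S Rw : {set 'I_m}) (xs : seq {ffun 'I_n -> int})
    (f g : U -> {ffun 'I_n -> int}) (us : seq U) rest :
  #|S :&: Rw| = size xs ->
  (forall x i, x \in xs -> i \in S -> i \notin Rw -> ecol ends x i = 0) ->
  (forall (u : U) i, u \in us -> i \in S -> i \notin Rw -> ecol ends (f u - g u) i = 0) ->
  pmc (xs ++ map f us ++ rest) S = pmc (xs ++ map g us ++ rest) S.
Proof.
move=> sz van; elim: us rest => [//|u us IH] rest vfg /=.
rewrite pm_move (pmD (y := g u) (z := f u - g u)); last first.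
  by move=> i _; rewrite -ecolD addrC subrK.
rewrite [X in _ + X](@pm_excess _ _ _ _ Rw ((f u - g u) :: xs)) ?addr0 //=; last first.
- move=> x i; rewrite inE => /predU1P[->|xx] iS iR; last exact: van.
  by apply: vfg => //; rewrite mem_head.
- by rewrite sz.
have -> : pmc (g u :: xs ++ map f us ++ rest) S = pmc (xs ++ map f us ++ (g u :: rest)) S.
  by rewrite [in RHS]catA pm_move -catA.
rewrite IH => [|w i wus]; last by apply: vfg; rewrite inE wus orbT.
by apply: pm_perm; rewrite perm_cat2l -cat1s perm_catCA.
Qed.

(** Each copy of [vx v] is rewritten, with its own edge of [rs], as that edge minus its other end;
    one of the two resulting permanents is nonzero. *)
Lemma pm_unfold v (rs : seq 'I_m) rest S :
  (forall e, e \in rs -> incident ends v e) ->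
  pmc (nseq (size rs) (vx v) ++ rest) S != 0 ->
  exists rs1 rs2, perm_eq (rs1 ++ rs2) rs /\
    pmc (map (eb ends) rs1 ++ map (fun e => vx (otherend e v)) rs2 ++ rest) S != 0.
Proof.
elim: rs rest => [|e rs IH] rest inc /=; first by exists [::], [::].
rewrite (pmD (y := eb ends e) (z := - vx (otherend e v))); last first.
  move=> i _; have /joins_opp/eb_joins -> : incident ends v e by rewrite inc ?mem_head.
  by rewrite -ecolD addrK.
have inc' f : f \in rs -> incident ends v f by move=> h; rewrite inc // inE h orbT.
have -> : pmc (- vx (otherend e v) :: nseq (size rs) (vx v) ++ rest) S =
          - pmc (vx (otherend e v) :: nseq (size rs) (vx v) ++ rest) S.
  rewrite (pm_sum (r := [:: tt]) (a := fun=> -1) (f := fun=> vx (otherend e v))) => [|i _].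
    by rewrite big_seq1 mulN1r.
  by rewrite big_seq1 /ecol !ffunE; ring.
have [z1|nz1] := eqVneq (pmc (eb ends e :: nseq (size rs) (vx v) ++ rest) S) 0.
  rewrite z1 add0r oppr_eq0 -pm_move => /IH [//|rs1 [rs2 [pr nz]]].
  exists rs1, (e :: rs2); split.
    by rewrite -cat1s perm_catCA /= perm_cons.
  by rewrite /= pm_move catA -pm_move -catA.
move=> _; move: nz1; rewrite -pm_move => /IH [//|rs1 [rs2 [pr nz]]].
exists (e :: rs1), rs2; split; first by rewrite /= perm_cons.
by move: nz; rewrite catA pm_move -catA.
Qed.

(** The tokens [ts] are the leftover vertex columns and must lie in [Y]. The bound on [es] also
    forces its edges to lie inside [X]. *)
Definition token_config X (Y : {set 'I_n}) := exists (ts : seq 'I_n) (es : seq 'I_m),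
  [/\ uniq ts, {subset ts <= Y}, forall e, (count_mem e es <= 2 * (e \in rows X))%N &
      pmc (map (@vx n) ts ++ map (eb ends) es) (rows X) != 0].

(* While all [d] columns [vx v] are present, adding [vx v] to another column does not
   change the permanent; this turns a token [vx u] into the edge [uv]. *)
Lemma token_step X v : v \notin X -> token_config X X -> token_config (v |: X) X.
Proof.
move=> vX [ts [es [uts tsX ces nz]]].
(* [Rw] consists of the edges from [v] to [X]; the column [vx v] vanishes on the other rows of
   [S]. *)
set S := rows (v |: X); pose Rw := S :\: rows X.
have RwP e : e \in Rw -> incident ends v e /\ otherend e v \in X.
  rewrite !inE negb_and => /andP[nb /andP[e1 e2]].
  have := ends_neq simple e; rewrite /incident /otherend.
  case: eqP e1 nb => [-> _ _ ne|_ /= e1] /=.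
    by split=> //; move: e2; rewrite eq_sym (negPf ne).
  by rewrite e1 /=; move: e2; case: eqP => //= _ -> //.
have inR e u : u \in X -> joins e v u -> e \in Rw.
  move=> uX /orP[] /andP[/eqP E1 /eqP E2]; rewrite !inE E1 E2 eqxx uX (negPf vX) ?orbT //.
have sRS : Rw \subset S by apply: subsetDl.
have SR : S :\: Rw = rows X.
  rewrite setDDr setDv set0U; apply/setIidPr/subsetP => e; rewrite !inE => /andP[-> ->].
  by rewrite !orbT.
have van i : i \in S -> i \notin Rw -> ecol ends (vx v) i = 0.
  move=> iS iR; apply: ecol_vx0; have : i \in rows X by rewrite -SR inE iR.
  rewrite inE /incident => /andP[i1 i2]; rewrite negb_or.
  by apply/andP; split; [apply: contraNneq vX => <- | apply: contraNneq vX => <-].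
have van' x i : x \in nseq #|Rw| (vx v) -> i \in S -> i \notin Rw -> ecol ends x i = 0.
  by move/nseqP=> [-> _]; apply: van.
have nz1 : pmc (nseq #|Rw| (vx v) ++ map (@vx n) ts ++ map (eb ends) es) S != 0.
  rewrite (pm_block (Rw := Rw)) ?size_nseq // SR mulf_neq0 // pm_nseq mulf_neq0 //.
    by rewrite pnatr_eq0 -lt0n fact_gt0.
  by apply/prodf_neq0 => i /RwP[/ecol_vx_neq0].
(* [h u] is the edge from [v] to the token [u], if there is one. *)
pose h u := [pick e in Rw | joins e v u].
have hP u e : h u = Some e -> e \in Rw /\ joins e v u.
  by rewrite /h; case: pickP => // f /andP[fR j] [<-].
pose f u := if h u is Some e then eb ends e else vx u.
have nz2 : pmc (nseq #|Rw| (vx v) ++ map f ts ++ map (eb ends) es) S != 0.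
  rewrite (pm_shift (Rw := Rw) (g := @vx n)) //.
    by rewrite size_nseq (setIidPr sRS).
  move=> u i uts' iS iR; rewrite /f; case E: (h u) => [e|]; last by rewrite subrr /ecol !ffunE subrr.
  by have [_ /eb_joins ->] := hP _ _ E; rewrite addrK van.
have nz3 : pmc (nseq (size (enum Rw)) (vx v) ++
    map (@vx n) [seq u <- ts | h u == None] ++ map (eb ends) (pmap h ts ++ es)) S != 0.
  rewrite -cardE; suff /pm_perm -> : perm_eq (nseq #|Rw| (vx v) ++
    map (@vx n) [seq u <- ts | h u == None] ++ map (eb ends) (pmap h ts ++ es))
    (nseq #|Rw| (vx v) ++ map f ts ++ map (eb ends) es) by [].
  rewrite perm_cat2l map_cat catA perm_cat2r; elim: (ts) => [//|u us IH] /=.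
  case E: (h u) => [e|] /=.
    have -> : f u = eb ends e by rewrite /f E.
    by rewrite -cat1s perm_catCA /= perm_cons.
  have -> : f u = vx u by rewrite /f E.
  by rewrite perm_cons.
(* Each copy of [vx v] gets a different edge of [Rw]. The new tokens are distinct neighbours of [v],
   while the tokens kept are not adjacent to [v], so none is repeated. *)
have [e|rs1 [rs2 [prs nz4]]] := pm_unfold _ nz3.
  by rewrite mem_enum => /RwP[].
have mrs e : e \in rs1 ++ rs2 -> e \in Rw by rewrite (perm_mem prs) mem_enum.
have urs : uniq (rs1 ++ rs2) by rewrite (perm_uniq prs) enum_uniq.
have mrs2 e : e \in rs2 -> e \in Rw by move=> h2; apply: mrs; rewrite mem_cat h2 orbT.
exists ([seq u <- ts | h u == None] ++ [seq otherend e v | e <- rs2]), (rs1 ++ pmap h ts ++ es).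
have upm : uniq (pmap h ts).
  move: uts; elim: (ts) => [//|u us IH] /= /andP[uus /IH uq].
  case E: (h u) => [e|//] /=; rewrite uq andbT mem_pmap.
  apply: contra uus => /mapP[w wus E2]; have [_ j1] := hP _ _ E; have [_ j2] := hP _ _ (esym E2).
  by rewrite -(joins_oppE j1) (joins_oppE j2).
have mpm e : e \in pmap h ts -> e \in Rw.
  by rewrite mem_pmap => /mapP[u _ /esym/hP[]].
split.
- rewrite cat_uniq filter_uniq //=; apply/andP; split.
    apply/hasPn => u /mapP[e /mrs2 eR ->]; rewrite mem_filter negb_and.
    have [inc _] := RwP _ eR; apply/orP; left; rewrite /h.
    by case: pickP => // /(_ e); rewrite eR joins_opp.
  rewrite map_inj_in_uniq; first by move: urs; rewrite cat_uniq => /and3P[].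
  move=> e1 e2 /mrs2/RwP[/joins_opp j1 _] /mrs2/RwP[/joins_opp j2 _] E.
  by rewrite E in j1; apply: joins_inj j1 j2.
- move=> u; rewrite mem_cat mem_filter => /orP[/andP[_ /tsX] //|/mapP[e /mrs2/RwP[_ oX] ->//]].
(* An edge of [Rw] is used at most once in [rs1] and once in [pmap h ts], and not in [es], whose
   edges lie inside [X]. *)
- move=> e; rewrite !count_cat.
  have c1 : (count_mem e rs1 <= (e \in Rw))%N.
    move: urs; rewrite cat_uniq => /andP[u1 _]; rewrite count_uniq_mem //.
    by case: (boolP (e \in rs1)) => // e1; rewrite mrs // mem_cat e1.
  have c2 : (count_mem e (pmap h ts) <= (e \in Rw))%N.
    by rewrite count_uniq_mem //; case: (boolP (_ \in pmap _ _)) => // /mpm ->.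
  have c3 := ces e.
  have : ((e \in Rw) + (e \in rows X) <= (e \in S))%N.
    rewrite [e \in Rw]inE; case: (boolP (e \in rows X)) => /= eX; last by rewrite addn0.
    by have -> : e \in S by move: eX; rewrite -SR => /setDP[].
  by move: c1 c2 c3; rewrite -/S; lia.
- have /pm_perm -> // : perm_eq
    (map (@vx n) ([seq u <- ts | h u == None] ++ [seq otherend e v | e <- rs2]) ++
      map (eb ends) (rs1 ++ pmap h ts ++ es))
    (map (eb ends) rs1 ++ map (fun e => vx (otherend e v)) rs2 ++
      map (@vx n) [seq u <- ts | h u == None] ++ map (eb ends) (pmap h ts ++ es)).
  rewrite map_cat [map _ (rs1 ++ _)]map_cat -map_comp -!catA.
  rewrite [X in perm_eq X]catA perm_catCA perm_cat2l.
  by rewrite [X in perm_eq _ X]catA perm_cat2r perm_catC.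
Qed.

Lemma token_exists X : token_config X X.
Proof.
move: {2}#|X| (leqnn #|X|) => k; elim: k X => [|k IH] X.
  rewrite leqn0 cards_eq0 => /eqP ->; exists [::], [::]; split=> //=.
  suff -> : rows set0 = set0 by rewrite /pm eqxx.
  by apply/setP => e; rewrite !inE.
have [->|[v vX]] := set_0Vmem X; first by rewrite cards0 => _; apply: IH; rewrite cards0.
rewrite (cardsD1 v) vX => le; have := token_step (negbT (setD11 v X)) (IH _ le).
rewrite setD1K // => -[ts [es [u s c nz]]]; exists ts, es; split=> // w /s.
by case/setD1P.
Qed.

(** [token_step] leaves no token on the vertex it adds, so adding [w] last keeps [w] free. *)
Lemma token_exists_avoiding X w : token_config X (X :\ w).
Proof.
have [wX|wX] := boolP (w \in X).
  by rewrite -{1}(setD1K wX); apply: token_step (token_exists _); rewrite setD11.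
have -> : X :\ w = X by apply/setDidPl; rewrite disjoint_sym disjoints1.
exact: token_exists.
Qed.

End Tokens.

(** * Trees as lists of leaves *)

Section Tree.
Variables (V : eqType) (r : rel V) (root : V).
Hypothesis symr : ssrbool.symmetric r.

(** Entries pair a vertex with its parent, latest first, so that removing the head removes a
    leaf. *)
Fixpoint tree (vs : seq (V * V)) : bool :=
  if vs is q :: vs' then
    [&& tree vs', q.1 \notin root :: unzip1 vs', q.2 \in root :: unzip1 vs' & r q.1 q.2]
  else true.

Lemma tree_path vs x p : tree vs -> x \in root :: unzip1 vs -> path r x p ->
  exists2 vs', tree vs' &
    {subset root :: unzip1 vs <= root :: unzip1 vs'} /\ last x p \in root :: unzip1 vs'.
Proof.
elim: p x vs => [|y p IH] x vs tvs xvs /=; first by exists vs; last split.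
case/andP=> rxy pp; have [yvs|yvs] := boolP (y \in root :: unzip1 vs); first exact: IH.
have [||vs' t' [s' l']] := IH y ((y, x) :: vs) _ _ pp.
- by rewrite /= tvs yvs xvs symr.
- by rewrite /= !inE eqxx orbT.
exists vs' => //; split=> // z zvs; apply: s'; move: zvs; rewrite /= !inE.
by case/orP=> ->; rewrite ?orbT.
Qed.

End Tree.

Lemma tree_cover (V : finType) (r : rel V) (root : V) (ys : seq V) :
  ssrbool.symmetric r -> (forall y, y \in ys -> connect r root y) ->
  exists2 vs, tree r root vs & {subset ys <= root :: unzip1 vs}.
Proof.
move=> symr; elim: ys => [|y ys IH] con; first by exists [::].
have [z zys|vs tvs sub] := IH; first by apply: con; rewrite inE zys orbT.
have /connectP[p pp ->] := con y (mem_head _ _).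
have [vs' t' [s' l']] := tree_path symr tvs (mem_head _ _) pp.
by exists vs' => // z; rewrite inE => /predU1P[->|/sub/s'].
Qed.

(** * Routes along a tree *)

Section Route.
Variables (n m : nat) (ends : 'I_m -> 'I_n * 'I_n).
Hypothesis simple : simple_graph ends.

Definition dl (u v : 'I_n) : {ffun 'I_m -> int} := [ffun e => (joins ends e u v)%:R].

Lemma bd_dl u v : adj ends u v -> bd ends (dl u v) = vx u + vx v.
Proof.
case/existsP=> e0 j0; rewrite /bd (bigD1 e0) //= ffunE j0 (eb_joins j0) big1 ?addr0 // => e ne.
by rewrite ffunE; case: (boolP (joins ends e u v)) => // /(joins_inj simple j0) E; rewrite E eqxx in ne.
Qed.

Lemma dl_neq0 u v e : (dl u v e != 0) = joins ends e u v.
Proof. by rewrite ffunE; case: joins. Qed.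

(* An item [(s, v, (eps, M))] is a route from [s] to [v]: the alternating sum [M] of the
   edges of a walk has boundary [vx s + eps vx v]. *)
Definition item : Type := 'I_n * 'I_n * (int * {ffun 'I_m -> int}).
Definition org (t : item) := t.1.1.
Definition pos (t : item) := t.1.2.
Definition valid (t : item) :=
  (t.2.1 ^+ 2 == 1) && (bd ends t.2.2 == vx (org t) + vx (pos t) *~ t.2.1).
Definition itemuse (L : seq item) e := count (fun t : item => t.2.2 e != 0) L.

(** Signs alternate along the walk, so the edge to [p] cancels the old end. *)
Definition imove (p : 'I_n) (t : item) : item :=
  (org t, p, (- t.2.1, t.2.2 - dl (pos t) p *~ t.2.1)).
(** For two routes with the same end, the signs cancel that end and leave the two origins, the
    second one stored as [pos]. *)
Definition ijoin (t u : item) : item :=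
  (org t, org u, (- (t.2.1 * u.2.1), t.2.2 - u.2.2 *~ (t.2.1 * u.2.1))).

Lemma imove_valid p t : adj ends (pos t) p -> valid t -> valid (imove p t).
Proof.
case: t => [[s v] [e M]] /= ad /andP[/= /eqP e2 /eqP E]; rewrite /valid /= sqrrN e2 eqxx /=.
rewrite bdB bdMz bd_dl // E /org /pos /=; apply/eqP/ffunP => x.
by rewrite !ffunE !ffunMzE !ffunE !mulrzz; ring.
Qed.

Lemma ijoin_valid t u : pos t = pos u -> valid t -> valid u -> valid (ijoin t u).
Proof.
case: t u => [[s v] [e M]] [[s' v'] [e' M']]; rewrite /valid /pos /org /= => <-.
move=> /andP[/eqP e2 /eqP E] /andP[/eqP e2' /eqP E'].
rewrite sqrrN exprMn e2 e2' mulr1 eqxx /=.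
rewrite bdB bdMz E E'; apply/eqP/ffunP => x.
rewrite !ffunE !ffunMzE !ffunE !ffunMzE !ffunE !mulrzz.
have -> : forall a b c : int, a + b * e - (c + b * e') * (e * e') = a + b * e - c * (e * e') - b * e * e' ^+ 2.
  by move=> a b c; ring.
by rewrite e2'; ring.
Qed.

Lemma imove_use p t e : (((imove p t).2.2 e != 0)%R <= (t.2.2 e != 0)%R + joins ends e (pos t) p)%N.
Proof.
rewrite /imove /= !ffunE ffunMzE !ffunE.
case: joins; first by rewrite addn1; case: (_ == 0 :> int).
by rewrite mul0rz subr0 addn0.
Qed.

Lemma ijoin_use t u e : (((ijoin t u).2.2 e != 0)%R <= (t.2.2 e != 0)%R + (u.2.2 e != 0)%R)%N.
Proof.
rewrite /ijoin /= !ffunE ffunMzE.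
have [->|_] := eqVneq (t.2.2 e) 0; have [->|_] := eqVneq (u.2.2 e) 0 => //=.
- by rewrite mul0rz subrr eqxx.
- by case: (_ == 0 :> int).
- by case: (_ == 0 :> int).
- by case: (_ == 0 :> int).
Qed.

Lemma itemuse_cons t L e : itemuse (t :: L) e = ((t.2.2 e != 0)%R + itemuse L e)%N.
Proof. by []. Qed.

Lemma pick_pos (L : seq item) v : v \in map pos L ->
  exists2 t, pos t = v & exists L0, perm_eq L (t :: L0).
Proof.
case/mapP=> t tL ->; exists t => //; exists (rem t L); exact: perm_to_rem.
Qed.

(* Routes are pushed from the leaves to the root and closed as soon as two of them meet,
   so no tree edge is used twice. *)
Lemma route (r : rel 'I_n) root vs : tree r root vs ->
  (forall u v, r u v -> adj ends u v) ->
  forall L : seq item, uniq (map pos L) -> {subset map pos L <= root :: unzip1 vs} ->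
  all valid L ->
  exists C L' : seq item,
  [/\ perm_eq (map org C ++ map pos C ++ map org L') (map org L),
      all valid (C ++ L'),
      (size L' <= 1)%N /\ (forall t, t \in L' -> pos t = root) &
      forall e, (itemuse (C ++ L') e <= itemuse L e + count (fun q => joins ends e q.1 q.2) vs)%N].
Proof.
move=> tvs radj; elim: vs tvs => [|[v p] vs IH] /= tvs L uL sL vL.
  (* Only the root is left; positions are distinct, so at most one route remains open. *)
  exists [::], L; split=> //=; last by move=> e; rewrite addn0.
  have aL t : t \in L -> pos t = root.
    by move=> tL; apply/eqP; move: (sL _ (map_f pos tL)); rewrite inE.
  split=> //; case: L uL aL {sL vL} => [|t [|t' L]] //= /andP[]; rewrite inE => + _ aL.
  by rewrite (aL t) ?(aL t') ?eqxx // !inE eqxx ?orbT.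
case/and4P: tvs => tvs vvs pvs rvp.
have [vL'|vL'] := boolP (v \in map pos L); last first.
  have [//|x xL|//|C [L' [p1 p2 p3 p4]]] := IH tvs L.
    have := sL _ xL; rewrite !inE => /or3P[->//|/eqP E|->]; rewrite ?orbT //.
    by rewrite -E xL in vL'.
  by exists C, L'; split=> // e; apply: leq_trans (p4 e) _; rewrite leq_add2l leq_addl.
have [t tv [L0 pL]] := pick_pos vL'.
have useL e : itemuse L e = ((t.2.2 e != 0)%R + itemuse L0 e)%N.
  by rewrite /itemuse (permP pL).
have := perm_map pos pL => pLp; have := perm_map org pL => pLo.
move: uL sL vL; rewrite (perm_uniq pLp) (perm_all _ pL) /= tv => /andP[vL0 uL0] sL /andP[vt vaL0].
have sL0 x : x \in map pos L0 -> x \in root :: unzip1 vs.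
  move=> xL0; have : x \in map pos L by rewrite (perm_mem pLp) inE xL0 orbT.
  move/sL; rewrite !inE => /or3P[->//|/eqP E|->]; rewrite ?orbT //.
  by rewrite -E xL0 in vL0.
have vm : valid (imove p t) by apply: imove_valid => //; rewrite tv; apply: radj.
(* The route at [v] moves to the parent [p]; if another route stands there, the two are closed.
   Positions stay distinct. *)
have [pL0|pL0] := boolP (p \in map pos L0); last first.
  have [|x||C [L' [p1 p2 p3 p4]]] := IH tvs (imove p t :: L0).
  - by rewrite /= pL0.
  - by rewrite /= inE => /predU1P[->|/sL0//].
  - by rewrite /= vm.
  exists C, L'; split=> //; first by rewrite (perm_trans p1) // perm_sym.
  move=> e; have := p4 e; have := imove_use p t e; rewrite useL itemuse_cons tv.
  move: (_ != 0) (t.2.2 e != 0) (itemuse _ _) (itemuse _ _) (joins _ _ _ _) (count _ _).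
  by clear; lia.
have [u up [L1 pL1]] := pick_pos pL0.
have useL0 e : itemuse L0 e = ((u.2.2 e != 0)%R + itemuse L1 e)%N.
  by rewrite /itemuse (permP pL1).
have := perm_map pos pL1 => pL1p; have := perm_map org pL1 => pL1o.
move: uL0 vaL0; rewrite (perm_uniq pL1p) (perm_all _ pL1) /= => /andP[uL1 uqL1] /andP[vu vL1].
have [|x xL1||C [L' [p1 p2 p3 p4]]] := IH tvs L1 => //.
  by apply: sL0; rewrite (perm_mem pL1p) inE xL1 orbT.
exists (ijoin (imove p t) u :: C), L'; split=> //.
- rewrite /= perm_sym (perm_trans pLo) //= perm_cons (perm_trans pL1o) //= perm_sym.
  by rewrite -cat1s perm_catCA /= perm_cons.
- by rewrite /= p2 ijoin_valid.
- move=> e; have := p4 e; have := imove_use p t e; have := ijoin_use (imove p t) u e.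
  rewrite cat_cons itemuse_cons useL useL0 tv.
  move: (_ != 0) ((imove p t).2.2 e != 0) (t.2.2 e != 0) (u.2.2 e != 0).
  move: (itemuse _ _) (itemuse _ _) (joins _ _ _ _) (count _ _).
  by clear; lia.
Qed.

(** The child of the head entry is new, whereas the entries of the tail have both ends among the
    earlier vertices. *)
Lemma tree_count (r : rel 'I_n) root vs e : tree r root vs ->
  (count (fun q => joins ends e q.1 q.2) vs <= 1)%N.
Proof.
elim: vs => [//|[v p] vs IH] /= /and4P[tvs vvs pvs _].
have [j|nj] := boolP (joins ends e v p); last by rewrite add0n IH.
have sub q : q \in vs -> q.2 \in root :: unzip1 vs.
  elim: (vs) tvs {IH vvs pvs} => [//|q' vs' IH'] /= /and4P[t' _ q'2 _].
  rewrite inE => /predU1P[->|/(IH' t')]; [move: q'2|]; rewrite /= !inE => /orP[->|->];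
    by rewrite ?orbT.
rewrite -[X in (_ <= X)%N]addn0 leq_add2l leqn0 -leqn0 leqNgt -has_count; apply/hasPn => q qvs.
apply/negP => jq; have q1 : q.1 \in root :: unzip1 vs by rewrite inE map_f ?orbT.
by case: (joins_eq j jq) => -[E _]; move: vvs; rewrite E ?q1 ?sub.
Qed.

Lemma tree_rel (r : rel 'I_n) root vs q : tree r root vs -> q \in vs -> r q.1 q.2.
Proof.
by elim: vs => [//|q' vs IH] /= /and4P[t _ _ rq]; rewrite inE => /predU1P[->|/(IH t)].
Qed.

End Route.

(** * Choosing the independent set *)

Section Split.
Variables (n m : nat) (ends : 'I_m -> 'I_n * 'I_n).
Hypothesis simple : simple_graph ends.
Variable C : {set 'I_n}.
Hypothesis closedC : forall u v, adj ends u v -> u \in C -> v \in C.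
Implicit Types (A : {set 'I_n}) (a b u v x : 'I_n).

Definition nbA A b := [set a in A | adj ends a b].
Definition twins A b := [set b' in C :\: A | nbA A b' == nbA A b].
(** [twins A b] contains [b] itself, hence the bound [1 <]. *)
Definition clustered A :=
  [set b in C :\: A | (#|nbA A b| == 1)%N && (1 < #|twins A b|)%N].
Definition odds A := [set b in C :\: A | odd #|nbA A b| && (b \notin clustered A)].

Definition indep A := (A \subset C) && [forall u in A, forall v in A, ~~ adj ends u v].

(** Domination and cliques come from maximality. The hub is the root for routing: a route left open
    there can be completed by a neighbour of the hub that differs from a prescribed vertex. *)
Record splitting A : Prop := Splitting {
  split_sub : A \subset C;
  split_indep : forall u v, u \in A -> v \in A -> ~~ adj ends u v;
  split_dom : forall b, b \in C :\: A -> nbA A b != set0;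
  split_clique : forall b b', b \in C :\: A -> b' \in C :\: A -> b != b' ->
    #|nbA A b| = 1%N -> nbA A b = nbA A b' -> adj ends b b';
  split_hub : odds A != set0 -> exists2 h, h \in C :\: A & (1 < #|nbA A h|)%N }.

Lemma indepP A : reflect (A \subset C /\ forall u v, u \in A -> v \in A -> ~~ adj ends u v) (indep A).
Proof.
apply: (iffP andP) => -[sA h]; split=> //.
  by move=> u v uA vA; move/forall_inP: h => /(_ u uA)/forall_inP; apply.
by apply/forall_inP => u uA; apply/forall_inP => v; apply: h.
Qed.

Lemma adj_irr u : adj ends u u = false.
Proof. by apply/negbTE/negP => /(adj_neq simple); rewrite eqxx. Qed.

Lemma indep_exchange A (D : {set 'I_n}) b : indep A -> D \subset A -> b \in C ->
  nbA A b \subset D -> indep (b |: (A :\: D)).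
Proof.
move=> /indepP[sA h] DA bC nb; apply/indepP; split.
  by apply/subsetP => x; rewrite !inE => /predU1P[->//|/andP[_ /(subsetP sA)]].
have key x : x \in A :\: D -> ~~ adj ends x b.
  case/setDP=> xA xD; apply: contra xD => ad; apply: (subsetP nb).
  by rewrite inE xA.
move=> u v; rewrite !inE -!in_setD => /predU1P[->|uA] /predU1P[->|vA].
- by rewrite adj_irr.
- by rewrite adjC key.
- exact: key.
- by apply: h; [case/setDP: uA | case/setDP: vA].
Qed.

Definition maxindep A := indep A /\ forall A', indep A' -> (#|A'| <= #|A|)%N.

Lemma maxindep_exists : exists A, maxindep A.
Proof.
have i0 : indep set0 by apply/indepP; split; [apply: sub0set | move=> u v; rewrite inE].
case: (@arg_maxnP _ set0 indep (fun A => #|A|) i0) => A iA mA.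
by exists A; split=> // A' /mA.
Qed.

Lemma maxindep_dom A b : maxindep A -> b \in C :\: A -> nbA A b != set0.
Proof.
move=> [iA mA] /setDP[bC bA]; apply/negP => /eqP n0.
have /mA : indep (b |: (A :\: set0)).
  by apply: indep_exchange; rewrite ?sub0set // n0.
by rewrite setD0 cardsU1 bA add1n ltnn.
Qed.

(** Two nonadjacent twins could together replace their only neighbour in [A], which would enlarge
    [A]. *)
Lemma maxindep_clique A b b' : maxindep A ->
  b \in C :\: A -> b' \in C :\: A -> b != b' ->
    #|nbA A b| = 1%N -> nbA A b = nbA A b' -> adj ends b b'.
Proof.
move=> [iA mA] /setDP[bC bA] /setDP[b'C b'A] bb' /eqP/cards1P[a na] nbE.
have aA : a \in A by have := set11 a; rewrite -na inE => /andP[].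
apply: contraT => nad.
have i1 : indep (b |: (A :\: [set a])).
  by apply: indep_exchange; rewrite ?sub1set ?na.
have /mA : indep (b' |: ((b |: (A :\: [set a])) :\: set0)).
  apply: indep_exchange; rewrite ?sub0set //.
  apply/subsetP => x; rewrite inE !inE => /andP[/predU1P[->|/andP[xa xA]] ad].
    by rewrite ad in nad.
  have : x \in nbA A b' by rewrite inE xA.
  by rewrite -nbE na inE (negPf xa).
rewrite setD0 !cardsU1 !inE (negPf b'A) (negPf bA) eq_sym (negPf bb') !andbF /=.
by rewrite (cardsD1 a A) aA !add1n ltnn.
Qed.

(* If a maximum independent set has no hub, an odd vertex [b0] has a neighbour [a0] of
   degree one, and replacing [a0] by [b0] creates a hub because [b0 a0] is not isolated. *)
Lemma splitting_exists : nice ends -> exists A, splitting A.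
Proof.
move=> nc; have [A mxA] := maxindep_exists; have [iA mA] := mxA.
have [sA hA] := indepP _ iA.
have [/existsP[h /andP[hC hn]]|/existsPn noh] := boolP [exists h, (h \in C :\: A) && (1 < #|nbA A h|)%N].
  exists A; split=> //; [by move=> b; apply: maxindep_dom|by move=> b c; apply: maxindep_clique|by exists h].
have [o0|[b0 b0O]] := set_0Vmem (odds A).
  exists A; split=> //; [by move=> b; apply: maxindep_dom|by move=> b c; apply: maxindep_clique|by rewrite o0 eqxx].
move: b0O; rewrite inE => /andP[b0B /andP[od ncl]].
have small b : b \in C :\: A -> exists a, nbA A b = [set a].
  move=> bB; apply/cards1P; move: (maxindep_dom mxA bB) (noh b).
  by rewrite bB -card_gt0 /= -leqNgt eqn_leq => -> ->.
have [a0 na0] := small _ b0B.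
(* [b0] is not clustered, so no other vertex shares its single neighbour [a0]. *)
have tw b : b \in C :\: A -> nbA A b = [set a0] -> b = b0.
  move=> bB nb; apply/eqP; apply: contraNT ncl => ne.
  rewrite inE b0B na0 cards1 eqxx /=; apply/card_gt1P; exists b, b0; split=> //.
    by rewrite inE bB nb na0 eqxx.
  by rewrite inE b0B eqxx.
have [a0A ad0] : a0 \in A /\ adj ends a0 b0.
  by have := set11 a0; rewrite -na0 inE => /andP[].
have /setDP[b0C b0A] := b0B.
have a0C : a0 \in C by apply: (subsetP sA).
have na0b x : adj ends a0 x -> x = b0.
  move=> ax; have xC := closedC ax a0C.
  have xA : x \notin A by apply: contraL ax => /(hA _ _ a0A).
  have xB : x \in C :\: A by apply/setDP.
  have [a na] := small _ xB; apply: tw => //; rewrite na; congr [set _].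
  by have : a0 \in nbA A x by [rewrite inE a0A]; rewrite na inE => /eqP.
have [x ax xb] : exists2 x, adj ends b0 x & x != a0.
  apply/exists_inP; apply: contraT; rewrite negb_exists_in => /forall_inP no.
  have nb0 x : adj ends b0 x -> x = a0 by move/no; rewrite negbK => /eqP.
  have /existsP[e je] := ad0.
  have d1 : vdeg ends a0 = 1%N.
    apply/eqP/cards1P; exists e; apply/setP => f; rewrite !inE; apply/idP/eqP => [inc|->].
      have jo := joins_opp simple inc; have /na0b E : adj ends a0 (otherend ends f a0) by apply/existsP; exists f.
      by apply: (joins_inj simple) je; rewrite -E.
    exact: joins_incident je.
  have d2 : vdeg ends b0 = 1%N.
    apply/eqP/cards1P; exists e; apply/setP => f; rewrite !inE; apply/idP/eqP => [inc|->].
      have jo := joins_opp simple inc; have /nb0 E : adj ends b0 (otherend ends f b0) by apply/existsP; exists f.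
      by apply: (joins_inj simple) je; rewrite joinsC -E.
    by rewrite joinsC in je; exact: joins_incident je.
  by case: (nc e); case/orP: je => /andP[/eqP -> /eqP ->].
have xA : x \notin A.
  apply: contra xb => xA; have : x \in nbA A b0 by rewrite inE xA adjC.
  by rewrite na0 inE.
have xC := closedC ax b0C.
have xB : x \in C :\: A by apply/setDP.
have [a1 na1] := small _ xB.
have [a1A ad1] : a1 \in A /\ adj ends a1 x.
  by have := set11 a1; rewrite -na1 inE => /andP[].
have a10 : a1 != a0.
  apply: contraL ax => /eqP E; rewrite E in na1; rewrite (tw x) //.
  by rewrite adj_irr.
(* The exchange keeps the size, so [A'] is again maximum, and [x] now has the two neighbours [a1]
   and [b0] in it. *)
pose A' := b0 |: (A :\: [set a0]).
have iA' : indep A' by apply: indep_exchange; rewrite ?sub1set ?na0.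
have cA' : #|A'| = #|A| by rewrite cardsU1 !inE (negPf b0A) andbF (cardsD1 a0 A) a0A.
have mxA' : maxindep A' by split=> // D /mA; rewrite cA'.
have [sA' hA'] := indepP _ iA'.
exists A'; split=> //; [by move=> b; apply: maxindep_dom|by move=> b c; apply: maxindep_clique|].
move=> _; exists x.
  by rewrite !inE negb_or (negPf xA) andbF xC !andbT /=; apply: contraL ax => /eqP ->; rewrite adj_irr.
apply/card_gt1P; exists a1, b0; split.
- by rewrite !inE a10 a1A ad1 orbT.
- by rewrite !inE eqxx ax.
- by apply: contraNneq b0A => <-.
Qed.

End Split.

(** * Rows between [A] and its complement *)

Section Crossing.
Variables (n m : nat) (ends : 'I_m -> 'I_n * 'I_n).
Hypothesis simple : simple_graph ends.
Variable C : {set 'I_n}.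
Variable A : {set 'I_n}.
Hypothesis spA : splitting ends C A.

Local Notation B := (C :\: A).
Local Notation nb := (nbA ends A).

(** As [A] is independent, these are the edges with one end in [A] and the other in [B]. *)
Definition crossing := rows ends C :\: rows ends B.
Definition endA (i : 'I_m) := if (ends i).1 \in A then (ends i).1 else (ends i).2.
Definition endB (i : 'I_m) := if (ends i).1 \in A then (ends i).2 else (ends i).1.
Definition sgA (i : 'I_m) : int := if (ends i).1 \in A then 1 else -1.

Lemma crossingP i : i \in crossing ->
  [/\ endA i \in A, endB i \in B & joins ends i (endB i) (endA i)].
Proof.
have sub := subsetP (split_sub spA); have ind := split_indep spA.
rewrite !inE => /andP[nB /andP[c1 c2]].
have ad : adj ends (ends i).1 (ends i).2 by apply/existsP; exists i; apply: joins_ends.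
have J := joins_ends ends i.
rewrite /endA /endB; case: ifP => a1.
  have a2 : (ends i).2 \notin A by apply: contraL ad => /(ind _ _ a1).
  by rewrite a1 a2 c2 joinsC; split.
by move: nB; rewrite a1 c1 c2 /= andbT negbK => ->; split.
Qed.

Lemma crossing_joins i a b : a \in A -> b \in B -> joins ends i b a -> i \in crossing.
Proof.
move=> aA /setDP[bC bA]; have aC := subsetP (split_sub spA) _ aA.
by case/orP=> /andP[/eqP E1 /eqP E2]; rewrite !inE E1 E2 aA bC aC ?andbF.
Qed.

Lemma crossing_ends i a b : a \in A -> b \in B -> joins ends i b a -> endA i = a /\ endB i = b.
Proof.
move=> aA /setDP[bC bA]; rewrite /endA /endB.
by case/orP=> /andP[/eqP -> /eqP ->]; rewrite ?aA ?(negPf bA).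
Qed.

Lemma crossing_target :
  (\sum_(i in crossing) U_(endA i))%MM = (\sum_(b in B) \sum_(a in nb b) U_(a))%MM :> 'X_{1..n}.
Proof.
rewrite (partition_big endB (mem B)) => [|i /crossingP[]//] /=.
apply: eq_bigr => b bB; pose Sb := [set i in crossing | endB i == b].
have -> : nb b = endA @: Sb.
  apply/setP => a; rewrite inE; apply/andP/imsetP => [[aA /existsP[i]]|[i]].
    rewrite joinsC => j; have [Ea Eb] := crossing_ends aA bB j.
    by exists i => //; apply/setIdP; rewrite (crossing_joins aA bB j) Eb eqxx.
  move=> /setIdP[/crossingP[eA _ j] /eqP <-] ->; split=> //.
  by apply/existsP; exists i; rewrite joinsC.
rewrite big_imset /=; last first.
  move=> i j /setIdP[/crossingP[_ _ ji] /eqP Ei] /setIdP[/crossingP[_ _ jj] /eqP Ej] E.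
  by apply: (joins_inj simple) ji _; rewrite E Ei -Ej.
apply: eq_bigl => i; apply/andP/setIdP => -[]; by split.
Qed.

Lemma lin_vx (a : 'I_n) (k : int) : lin (vx a *~ k) = k *: 'X_a.
Proof.
rewrite /lin (bigD1 a) //= ffunMzE ffunE eqxx big1 ?addr0 => [|v va].
  by rewrite mulrzz mul1r.
by rewrite ffunMzE ffunE (negPf va) mul0rz scale0r.
Qed.

Lemma linD (y z : {ffun 'I_n -> int}) : lin (y + z) = lin y + lin z.
Proof. by rewrite /lin -big_split; apply: eq_bigr => v _; rewrite ffunE scalerDl. Qed.

Definition pvec (p : 'I_n * 'I_n * int) : {ffun 'I_n -> int} := vx p.1.1 + vx p.1.2 *~ p.2.

Lemma lin_pvec p : lin (pvec p) = binom p.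
Proof. by rewrite linD -[vx p.1.1]mulr1z !lin_vx scale1r. Qed.

(** All forms are supported on [A], so [pm_signed] gives a coefficient. The vertices [ts] contribute
    a monomial; the rest is [bprod_sqr] or, if [qs] has an entry, [bprod_sqr_lin]. *)
Lemma crossing_value (ts : seq 'I_n) ps qs :
  {subset ts <= A} ->
  (forall p, p \in ps ++ qs -> [/\ p.1.1 \in A, p.1.2 \in A & good p]) ->
  (size qs <= 1)%N ->
  (\sum_(i in crossing) U_(endA i))%MM =
    (\sum_(a <- ts) U_(a) + (btarget ps + \sum_(p <- qs) U_(p.1.1)))%MM ->
  pm (ecol ends) (map (fun a => vx a *~ 2) ts ++ map pvec ps ++ map pvec ps ++ map pvec qs) crossing != 0.
Proof.
move=> sts gps sqs tg.
set ys := _ ++ _.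
have ysA y : y \in ys -> forall v, v \notin A -> y v = 0.
  have pA p : p \in ps ++ qs -> forall v, v \notin A -> pvec p v = 0.
    case/gps=> p1 p2 _ v vA; rewrite !ffunE ffunMzE ffunE.
    have /negPf -> : v != p.1.1 by apply: contraNneq vA => ->.
    have /negPf -> : v != p.1.2 by apply: contraNneq vA => ->.
    by rewrite mul0rz.
  rewrite !mem_cat => /or4P[] /mapP[p pp ->]; try by apply: pA; rewrite mem_cat pp ?orbT.
  by move=> v vA; rewrite ffunMzE ffunE; case: eqP => [E|_]; rewrite ?mul0rz // E sts in vA.
have sz : size ys = #|crossing|.
  have sum1 (J : Type) (rs : seq J) (f : J -> 'I_n) : mdeg (\sum_(j <- rs) U_(f j))%MM = size rs.
    by rewrite mdeg_sum -sum1_size; apply: eq_bigr => j _; rewrite mdeg1.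
  have sumT : mdeg (btarget ps) = (2 * size ps)%N.
    rewrite mdeg_sum (eq_bigr (fun=> 2%N)) => [|p _]; last by rewrite mdegD !mdeg1.
    by rewrite big_const_seq count_predT iter_addn addn0.
  have := congr1 mdeg tg; rewrite !mdegD sumT !sum1 mdeg_sum.
  rewrite (eq_bigr (fun=> 1%N)) => [|i _]; last exact: mdeg1.
  by rewrite sum1_card => ->; rewrite !size_cat !size_map mul2n -addnn !addnA.
have E := pm_signed endA sgA sz; rewrite /= in E.
suff -> : pm (ecol ends) ys crossing = pm (fun (y : {ffun 'I_n -> int}) i => sgA i * y (endA i)) ys crossing; last first.
  rewrite -[ys]map_id; apply: eq_pm_map => y i /ysA y0 /crossingP[_].
  rewrite /ecol /sgA /endA /endB.
  case: ifP => i1 /setDP[_ iA] _; first by rewrite (y0 _ iA) subr0 mul1r.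
  by rewrite (y0 _ iA) sub0r mulN1r.
rewrite E tg !mulf_neq0 //.
- by apply/prodf_neq0 => i _; rewrite /sgA; case: ifP.
- rewrite pnatr_eq0 -lt0n; apply/prodn_gt0 => i; exact: fact_gt0.
rewrite /ys !big_cat !big_map /=.
have -> : \prod_(a <- ts) lin (vx a *~ 2) = (2 ^+ size ts) *: 'X_[(\sum_(a <- ts) U_(a))%MM].
  elim: (ts) => [|a s IH]; first by rewrite !big_nil expr0 scale1r mpolyX0.
  by rewrite !big_cons IH lin_vx mpolyXD -scalerAl -scalerAr scalerA -exprS.
have lpE rs : \prod_(p <- rs) lin (pvec p) = bprod rs by apply: eq_bigr => p _; rewrite lin_pvec.
rewrite !lpE -scalerAl mcoeffZ mulf_neq0 ?expf_neq0 //.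
rewrite [X in X@__]mulrC mcoeffMX mulrA -expr2.
have gp : all (@good n) ps by apply/allP => p pp; have [|_ _ ->//] := gps p; rewrite mem_cat pp.
case: qs sqs gps {E tg sz lpE ysA ys} => [|q [|//]] _ gps.
  by rewrite /bprod !big_nil mulr1 addm0 bprod_sqr.
rewrite {2}/bprod !big_seq1; apply: bprod_sqr_lin => //.
by have [|_ _ ->//] := gps q; rewrite mem_cat inE eqxx orbT.
Qed.

End Crossing.

Fixpoint pairup (T : Type) (s : seq T) : seq (T * T) :=
  if s is x :: s' then if s' is y :: s'' then (x, y) :: pairup s'' else [::] else [::].

Lemma pairup_perm (T : eqType) (s : seq T) : ~~ odd (size s) ->
  perm_eq (unzip1 (pairup s) ++ unzip2 (pairup s)) s.
Proof.
have [k] := ubnP (size s); elim: k s => [//|k IH] [|x [|y s]] //= le.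
rewrite negbK => od; rewrite perm_cons -cat1s perm_catCA /= perm_cons IH //.
by move: le; rewrite ltnS => /ltnW.
Qed.

Lemma pairup_neq (T : eqType) (s : seq T) q : uniq s -> q \in pairup s -> q.1 != q.2.
Proof.
have [k] := ubnP (size s); elim: k s => [//|k IH] [|x [|y s]] //= le.
rewrite !inE negb_or => /andP[/andP[xy _] /andP[_ us]] /predU1P[->//|]; apply: IH => //.
by move: le; rewrite ltnS => /ltnW.
Qed.

Lemma pairup_mem (T : eqType) (s : seq T) q : q \in pairup s -> q.1 \in s /\ q.2 \in s.
Proof.
have [k] := ubnP (size s); elim: k s => [//|k IH] [|x [|y s]] //= le.
rewrite !inE => /predU1P[->|/IH[|q1 q2]] /=; first by rewrite !eqxx ?orbT.
  by move: le; rewrite ltnS => /ltnW.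
by rewrite q1 q2 !orbT.
Qed.

(** * Joining odd vertices to one another or to the hub *)

Section Routing.
Variables (n m : nat) (ends : 'I_m -> 'I_n * 'I_n).
Hypothesis simple : simple_graph ends.
Variable C : {set 'I_n}.
Hypothesis closedC : forall u v, adj ends u v -> u \in C -> v \in C.
Hypothesis connC : forall x y, x \in C -> y \in C -> connect (adj ends) x y.
Variable A : {set 'I_n}.
Hypothesis spA : splitting ends C A.

Local Notation B := (C :\: A).
Local Notation nb := (nbA ends A).
Local Notation cl := (clustered ends C A).
Local Notation tw := (twins ends C A).
Local Notation od := (odds ends C A).
Local Notation J := (joins ends).

Lemma nbP a b : reflect (a \in A /\ adj ends a b) (a \in nb b).
Proof. by rewrite inE; apply: andP. Qed.

(** A vertex with two neighbours leaves a choice; two vertices with the same single neighbour would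
    be clustered. *)
Lemma odds_reps s s' : s \in od -> s' \in od -> s != s' ->
  exists a a', [/\ a \in nb s, a' \in nb s' & a != a'].
Proof.
have two x y : y \in od -> (1 < #|nb x|)%N -> exists a a', [/\ a \in nb x, a' \in nb y & a != a'].
  move=> /setIdP[/(split_dom spA)/set0Pn[a' a'y] _] /card_gt1P[a [c [ax cx ac]]].
  have [E|ne] := eqVneq a a'; last by exists a, a'.
  by exists c, a'; split=> //; rewrite -E eq_sym.
move=> so s'o ne; have [gt|le] := ltnP 1 #|nb s|; first exact: two.
have [gt|le'] := ltnP 1 #|nb s'|.
  by have [a [a' [h1 h2 h3]]] := two s' s so gt; exists a', a; rewrite eq_sym.
have /setIdP[sB /andP[_ ncl]] := so; have /setIdP[s'B _] := s'o.
have d1 : #|nb s| = 1%N by apply/eqP; rewrite eqn_leq le card_gt0 (split_dom spA).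
have d2 : #|nb s'| = 1%N by apply/eqP; rewrite eqn_leq le' card_gt0 (split_dom spA).
have [/cards1P[a na] /cards1P[a' na']] := (introT eqP d1, introT eqP d2).
exists a, a'; rewrite na na' !inE !eqxx; split=> //.
apply: contraNneq ncl => E; apply/setIdP; split=> //; rewrite d1 eqxx /=.
by apply/card_gt1P; exists s, s'; split=> //; apply/setIdP; rewrite ?na ?na' ?E eqxx.
Qed.

(* The edges inside a class of twins are already used by the triangles. *)
Definition ladj u v := [&& adj ends u v, u \in C, v \in C &
  ~~ [&& u \in cl, v \in cl & nb u == nb v]].

Lemma ladjC : ssrbool.symmetric ladj.
Proof.
move=> u v; rewrite /ladj adjC (eq_sym (nb u)).
by case: (u \in C); case: (v \in C); case: (u \in cl); case: (v \in cl).
Qed.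

Lemma cl_nb b : b \in cl -> exists a, nb b = [set a].
Proof. by case/setIdP=> _ /andP[/cards1P]. Qed.

Lemma clB b : b \in cl -> b \in B.
Proof. by case/setIdP. Qed.

(** A step inside a class of twins is replaced by a detour through the common neighbour in [A]. *)
Lemma ladj_connect x y : x \in C -> y \in C -> connect ladj x y.
Proof.
move=> xC yC; have /connectP[p pp ->] := connC xC yC.
elim: p x xC pp => [|z p IH] x xC /=; first by rewrite connect0.
case/andP=> xz pp; have zC := closedC xz xC; apply: connect_trans (IH _ zC pp).
have [/and3P[xcl zcl /eqP E]|nc] := boolP [&& x \in cl, z \in cl & nb x == nb z]; last first.
  by apply: connect1; rewrite /ladj xz xC zC.
have [a na] := cl_nb xcl.
have /nbP[aA ax] : a \in nb x by rewrite na set11.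
have /nbP[_ az] : a \in nb z by rewrite -E na set11.
have acl : (a \in cl) = false by apply/negbTE/negP => /clB/setDP[_]; rewrite aA.
have aC := subsetP (split_sub spA) _ aA.
apply: (@connect_trans _ _ a); apply: connect1; rewrite /ladj ?xC ?zC aC acl ?andbF //.
  by rewrite adjC ax.
by rewrite az.
Qed.

Lemma routing x0 : x0 \in C -> exists (h : 'I_n) (Cl L : seq (item n m)),
  [/\ perm_eq (map (@org n m) Cl ++ map (@pos n m) Cl ++ map (@org n m) L) (enum od),
      all (valid ends) (Cl ++ L),
      (size L <= 1)%N /\ (forall t, t \in L -> [/\ pos t = h, h \in B & (1 < #|nb h|)%N]),
      forall e, (itemuse (Cl ++ L) e <= 1)%N &
      forall e, (0 < itemuse (Cl ++ L) e)%N -> exists u v, J e u v /\ ladj u v].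
Proof.
move=> x0C; have [o0|on0] := eqVneq od set0.
  by exists x0, [::], [::]; split=> //=; rewrite o0 enum_set0.
have [h hB hn] := split_hub spA on0.
have hC : h \in C by case/setDP: hB.
have [y|vs tvs cov] := @tree_cover _ ladj h (enum od) ladjC.
  by rewrite mem_enum => /setIdP[/setDP[yC _] _]; apply: ladj_connect.
(* Routes of length zero: with sign [-1] the boundary [vx s - vx s] is that of the empty
   combination. *)
pose L0 := [seq (s, s, (-1, 0)) : item n m | s <- enum od].
have po : map (@pos n m) L0 = enum od by rewrite -map_comp map_id.
have oL : map (@org n m) L0 = enum od by rewrite -map_comp map_id.
have us0 e : itemuse L0 e = 0%N.
  by rewrite /itemuse count_map (eq_count (a2 := pred0)) ?count_pred0 // => s /=; rewrite ffunE eqxx.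
have [u v /andP[]//||||Cl [L [p1 p2 [p3 p3'] p4]]] := route simple tvs _ (L := L0).
- by rewrite po enum_uniq.
- by rewrite po.
- apply/allP => t /mapP[s _ ->]; apply/andP; split=> //=.
  have -> : bd ends 0 = 0 by rewrite /bd big1 // => e _; rewrite ffunE mulr0z.
  by rewrite /org /pos /= mulrN1z subrr.
exists h, Cl, L; split=> //; first by rewrite -oL.
- by split=> // t /p3' ->.
- by move=> e; apply: leq_trans (p4 e) _; rewrite us0 add0n (tree_count ends e tvs).
move=> e /leq_trans/(_ (p4 e)); rewrite us0 add0n -has_count => /hasP[q qvs jq].
by exists q.1, q.2; split=> //; apply: tree_rel tvs qvs.
Qed.

(** Each odd vertex is an end of at most one closed route, so the choices from [odds_reps] do not
    interfere. *)
Lemma leftovers (Cl : seq (item n m)) :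
  uniq (map (@org n m) Cl ++ map (@pos n m) Cl) ->
  (forall t, t \in Cl -> org t \in od /\ pos t \in od) ->
  exists lo : 'I_n -> 'I_n, (forall b, b \in od -> lo b \in nb b) /\
    (forall t, t \in Cl -> lo (org t) != lo (pos t)).
Proof.
elim: Cl => [_ _|t Cl IH] /=.
  exists (fun b => odflt b [pick a in nb b]); split=> // b /setIdP[bB _].
  by case: pickP => [a //|no]; have /set0Pn[a] := split_dom spA bB; rewrite no.
rewrite mem_cat inE negb_or negb_or => /andP[/andP[o1 /andP[op o2]] uq] tod.
have {uq}[p12 uq] : pos t \notin map (@org n m) Cl ++ map (@pos n m) Cl /\
    uniq (map (@org n m) Cl ++ map (@pos n m) Cl).
  by move: uq; rewrite -cat1s uniq_catCA cat1s /= => /andP[].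
have [u uCl|lo [lo1 lo2]] := IH uq; first by apply: tod; rewrite inE uCl orbT.
have [to tp] := tod _ (mem_head _ _).
have [a [a' [an a'n aa']]] := odds_reps to tp op.
exists (fun b => if b == org t then a else if b == pos t then a' else lo b); split.
  move=> b bo; case: eqP => [->//|_]; case: eqP => [->//|_]; exact: lo1.
move=> u; rewrite inE => /predU1P[->|uCl].
  by rewrite !eqxx [pos t == _]eq_sym (negPf op).
move: p12; rewrite mem_cat negb_or => /andP[p1 p2].
have ne (f : item n m -> 'I_n) x : x \notin map f Cl -> (f u == x) = false.
  by move=> nx; apply/negbTE; apply: contraNneq nx => <-; apply: map_f.
by rewrite !ne // lo2.
Qed.

End Routing.

Lemma next_neq (T : eqType) (s : seq T) x : uniq s -> x \in s -> (1 < size s)%N -> next s x != x.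
Proof.
move=> us xs; case: (rot_to xs) => i s' E; rewrite -(next_rot i us) -(size_rot i) E.
have : uniq (x :: s') by rewrite -E rot_uniq.
by case: s' {E} => [//|y s'] /=; rewrite eqxx inE negb_or eq_sym => /andP[/andP[]].
Qed.

(** * Triangles, connections and pairs, and their edge usage *)

Section Usage.
Variables (n m : nat) (ends : 'I_m -> 'I_n * 'I_n).
Hypothesis simple : simple_graph ends.
Variable C : {set 'I_n}.
Variable A : {set 'I_n}.
Hypothesis spA : splitting ends C A.

Local Notation B := (C :\: A).
Local Notation nb := (nbA ends A).
Local Notation cl := (clustered ends C A).
Local Notation tw := (twins ends C A).
Local Notation od := (odds ends C A).
Local Notation J := (joins ends).

Definition apex b := odflt b [pick a in nb b].
(** The cyclic order makes each vertex of a class of twins occur once as [b] and once as [nxt b]. *)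
Definition nxt b := next (enum (tw b)) b.
Definition tri b := dl ends b (apex b) + dl ends (nxt b) (apex b) - dl ends b (nxt b).

Lemma clusteredP b : b \in cl ->
  [/\ nb b = [set apex b], nxt b \in cl, nb (nxt b) = nb b & adj ends b (nxt b)].
Proof.
move=> bcl; have [a na] := cl_nb bcl.
have -> : apex b = a.
  by rewrite /apex na; case: pickP => [c|/(_ a)]; rewrite !inE ?eqxx // => /eqP.
have /setIdP[bB /andP[/eqP d1 tw1]] := bcl.
have btw : b \in enum (tw b) by rewrite mem_enum; apply/setIdP.
have : nxt b \in enum (tw b) by rewrite mem_next.
rewrite mem_enum => /setIdP[nB /eqP nE]; split=> //.
- apply/setIdP; split=> //; rewrite nE d1 eqxx /=.
  by have -> : tw (nxt b) = tw b by apply/setP => x; rewrite !in_set nE.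
- apply: (split_clique spA) => //.
  by rewrite eq_sym next_neq ?enum_uniq // -cardE.
Qed.

Lemma nxt_inj : {in cl &, injective nxt}.
Proof.
move=> b b' bcl b'cl E; have [_ _ n1 _] := clusteredP bcl; have [_ _ n2 _] := clusteredP b'cl.
have nE : nb b = nb b' by rewrite -n1 -n2 E.
have tE : tw b = tw b' by apply/setP => x; rewrite !in_set nE.
by apply: (can_inj (prev_next (enum_uniq (tw b)))); rewrite -/(nxt b) E /nxt tE.
Qed.

Lemma nb_adj a b : a \in nb b -> adj ends b a.
Proof. by case/nbP=> _; rewrite adjC. Qed.

Lemma apex_nb b : b \in cl -> apex b \in nb b.
Proof. by case/clusteredP=> ->; rewrite set11. Qed.

Lemma bd_tri b : b \in cl -> bd ends (tri b) = vx (apex b) *~ 2.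
Proof.
move=> bcl; have ab := apex_nb bcl; have [_ ncl nE ad] := clusteredP bcl.
rewrite bdB bdD !bd_dl //; try by apply: nb_adj; rewrite ?nE.
by apply/ffunP => x; rewrite ffunMzE !ffunE mulrzz; ring.
Qed.

(** The route is extended into [A] at both ends, which leaves a boundary on [a] and [a'] only. *)
Definition conn (t : item n m) a a' : {ffun 'I_m -> int} :=
  dl ends (org t) a - t.2.2 + dl ends (pos t) a' *~ t.2.1.

Lemma bd_conn t a a' : valid ends t -> adj ends (org t) a -> adj ends (pos t) a' ->
  bd ends (conn t a a') = pvec (a, a', t.2.1).
Proof.
move=> /andP[_ /eqP E] ad ad'; rewrite bdD bdB bdMz !bd_dl // E /pvec /=.
by apply/ffunP => x; rewrite !ffunE !ffunMzE !ffunE !mulrzz; ring.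
Qed.

Lemma conn_use t a a' e :
  ((conn t a a' e != 0)%R <= J e (org t) a + J e (pos t) a' + (t.2.2 e != 0)%R)%N.
Proof.
rewrite /conn !ffunE ffunMzE !ffunE.
case: (J e (org t) a) => /=; first by case: (_ == 0 :> int).
case: (J e (pos t) a') => /=; first by case: (_ == 0 :> int).
by rewrite mul0rz addr0 sub0r oppr_eq0.
Qed.

Lemma tri_use b e :
  ((tri b e != 0)%R <= J e b (apex b) + J e (nxt b) (apex b) + J e b (nxt b))%N.
Proof.
rewrite /tri !ffunE.
by case: (J e b (apex b)); case: (J e (nxt b) (apex b)); case: (J e b (nxt b)).
Qed.

Definition sqform (x : 'I_n * ('I_n * 'I_n)) : {ffun 'I_m -> int} :=
  dl ends x.1 x.2.1 - dl ends x.1 x.2.2.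

Lemma bd_sqform x : adj ends x.1 x.2.1 -> adj ends x.1 x.2.2 ->
  bd ends (sqform x) = pvec (x.2, -1).
Proof.
move=> ad ad'; rewrite bdB !bd_dl // /pvec /= mulrN1z.
by apply/ffunP => z; rewrite !ffunE; ring.
Qed.

Lemma sqform_use x e : ((sqform x e != 0)%R <= J e x.1 x.2.1 + J e x.1 x.2.2)%N.
Proof. by rewrite /sqform !ffunE; case: (J e x.1 x.2.1); case: (J e x.1 x.2.2). Qed.

Lemma odds_sub : od \subset B :\: cl.
Proof. by apply/subsetP => b /setIdP[bB /andP[_ ncl]]; apply/setDP. Qed.

Section Pairs.
Variables (lo : 'I_n -> 'I_n) (Cl L : seq (item n m)).
Hypothesis lo_nb : forall b, b \in od -> lo b \in nb b.
Hypothesis perm_od :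
  perm_eq (map (@org n m) Cl ++ map (@pos n m) Cl ++ map (@org n m) L) (enum od).

Definition nbE b := if b \in od then nb b :\ lo b else nb b.
Definition sqs := [seq (b, q) | b <- enum (B :\: cl), q <- pairup (enum (nbE b))].

Lemma nbE_even b : b \in B :\: cl -> ~~ odd (size (enum (nbE b))).
Proof.
case/setDP=> bB ncl; rewrite -cardE /nbE; case: ifPn => [bo|].
  have /setIdP[_ /andP[o _]] := bo.
  by move: o; rewrite (cardsD1 (lo b)) lo_nb.
by apply: contra => o; apply/setIdP; rewrite o ncl.
Qed.

(** Stated for any commutative monoid to serve twice: for the target monomial and for counting edge
    uses. A neighbour lies in a pair of [sqs] or is the leftover of an odd vertex, which belongs to
    one route. *)
Lemma pairs_big (R : Type) (idx : R) (op : Monoid.com_law idx) (g : 'I_n -> 'I_n -> R) :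
  \big[op/idx]_(b in B :\: cl) \big[op/idx]_(a in nb b) g b a =
  op (\big[op/idx]_(x <- sqs) op (g x.1 x.2.1) (g x.1 x.2.2))
    (op (\big[op/idx]_(t <- Cl) op (g (org t) (lo (org t))) (g (pos t) (lo (pos t))))
        (\big[op/idx]_(t <- L) g (org t) (lo (org t)))).
Proof.
rewrite (eq_bigr (fun b => op (\big[op/idx]_(a in nbE b) g b a)
   (if b \in od then g b (lo b) else idx))); last first.
  move=> b bB; rewrite /nbE; case: ifP => bo; last by rewrite Monoid.mulm1.
  by rewrite (big_setD1 (lo b)) ?lo_nb //= Monoid.mulmC.
rewrite big_split /=; congr (op _ _).
  rewrite /sqs big_allpairs_dep -big_enum /= big_seq [RHS]big_seq.
  apply: eq_bigr => b; rewrite mem_enum => bB.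
  rewrite -big_enum /= -(perm_big _ (pairup_perm (nbE_even bB))) big_cat /= !big_map /=.
  by rewrite -big_split.
rewrite -big_mkcondr /= (eq_bigl (mem od)) => [|b]; last first.
  by rewrite andb_idl // => bo; apply: (subsetP odds_sub).
rewrite -big_enum /= -(perm_big _ perm_od) !big_cat !big_map /= Monoid.mulmA.
by rewrite [in RHS]big_split.
Qed.

End Pairs.

Lemma sum_pred1 (T : finType) (S : {set T}) x : (\sum_(b in S) (b == x) = (x \in S) :> nat)%N.
Proof.
case: (boolP (x \in S)) => xS.
  by rewrite (bigD1 x) //= eqxx big1 // => b /andP[_ /negPf ->].
by rewrite big1 // => b bS; case: eqP => // E; rewrite -E bS in xS.
Qed.

Lemma usage_sum (Ms : seq {ffun 'I_m -> int}) e : usage Ms e = (\sum_(M <- Ms) (M e != 0)%R)%N.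
Proof. by rewrite /usage -sum1_count big_mkcond; apply: eq_bigr => M _; case: (M e != 0). Qed.

Definition uN e := (\sum_(b in B :\: cl) \sum_(a in nb b) J e b a)%N.
Definition uT e := (\sum_(b in cl) (J e b (apex b) + J e (nxt b) (apex b) + J e b (nxt b)))%N.

Lemma joins_crossing e a b : a \in A -> b \in B -> J e b a ->
  b = endB ends A e /\ a = endA ends A e.
Proof. by move=> aA bB j; have [-> ->] := crossing_ends aA bB j. Qed.

Lemma crossing_notBB e u v : e \in crossing ends C A -> u \in B -> v \in B -> J e u v = false.
Proof.
move=> /(crossingP spA)[aA bB j] uB vB; apply/negbTE/negP => j'.
by case: (joins_eq j j') => -[_ E]; move: aA; rewrite E; [case/setDP: vB|case/setDP: uB] => _ /negPf ->.
Qed.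

Lemma uN_crossing e : e \in crossing ends C A -> (uN e <= (endB ends A e \notin cl))%N.
Proof.
move=> ec; have [aA bB _] := crossingP spA ec.
have -> : (endB ends A e \notin cl) = (endB ends A e \in B :\: cl) by rewrite in_setD bB andbT.
rewrite -sum_pred1; apply: leq_sum => b /setDP[bB' _].
have [E|ne] := eqVneq b (endB ends A e); last first.
  rewrite big1 // => a /nbP[aA' _]; case: (boolP (J e b a)) => // /(joins_crossing aA' bB')[E].
  by rewrite E eqxx in ne.
apply: leq_trans (_ : \sum_(a in nb b) (a == endA ends A e) <= _)%N.
  apply: leq_sum => a /nbP[aA' _]; case: (boolP (J e b a)) => // /(joins_crossing aA' bB')[_ ->].
  by rewrite eqxx.
by rewrite sum_pred1 leq_b1.
Qed.

(** The edge from a clustered vertex to its apex lies only in the triangles of that vertex and of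
    its predecessor. *)
Lemma uT_crossing e : e \in crossing ends C A -> (uT e <= 2 * (endB ends A e \in cl))%N.
Proof.
move=> ec; rewrite /uT mul2n -addnn.
apply: leq_trans (_ : \sum_(b in cl) (b == endB ends A e) + \sum_(b in cl) (nxt b == endB ends A e) <= _)%N.
  rewrite -big_split; apply: leq_sum => b bcl.
  have [_ ncl nE _] := clusteredP bcl; have /nbP[aA _] := apex_nb bcl.
  rewrite (crossing_notBB ec (clB bcl) (clB ncl)) addn0 leq_add //.
    by case: (boolP (J e b _)) => // /(joins_crossing aA (clB bcl))[-> _]; rewrite eqxx.
  by case: (boolP (J e (nxt b) _)) => // /(joins_crossing aA (clB ncl))[-> _]; rewrite eqxx.
rewrite sum_pred1 leq_add2l -(big_imset (fun c => (c == endB ends A e) : nat) nxt_inj) sum_pred1.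
case: (boolP (_ \in nxt @: _)) => // /imsetP[b bcl ->].
by have [_ -> _ _] := clusteredP bcl.
Qed.

Lemma rowsB_notA e a v : e \in rows ends B -> a \in A -> J e v a = false.
Proof.
rewrite in_set => /andP[/setDP[_ e1] /setDP[_ e2]] aA; apply/negbTE/negP.
by case/orP=> /andP[/eqP E1 /eqP E2]; rewrite ?E1 ?E2 aA in e1 e2.
Qed.

Lemma uN_rowsB e : e \in rows ends B -> uN e = 0%N.
Proof. by move=> eB; apply: big1 => b _; apply: big1 => a /nbP[aA _]; rewrite rowsB_notA. Qed.

(** Such an edge can only be used from its two ends, and then it joins twins, which [ladj]
    excludes. *)
Lemma uT_rowsB e : e \in rows ends B -> (uT e <= 2)%N /\
  ((0 < uT e)%N -> forall u v, J e u v -> ~~ ladj ends C A u v).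
Proof.
move=> eB; have E : uT e = (\sum_(b in cl) J e b (nxt b))%N.
  by apply: eq_bigr => b bcl; have /nbP[aA _] := apex_nb bcl; rewrite !(rowsB_notA _ eB aA).
rewrite E; split.
  apply: leq_trans (_ : \sum_(b in cl) ((b == (ends e).1) + (b == (ends e).2)) <= _)%N.
    apply: leq_sum => b _; case: (boolP (J e b _)) => // /orP[/andP[/eqP <- _]|/andP[_ /eqP <-]];
    by rewrite eqxx ?addn1.
  by rewrite big_split /= !sum_pred1; do 2!case: (_ \in _).
rewrite lt0n sum_nat_eq0 negb_forall => /existsP[b]; rewrite negb_imply => /andP[bcl].
rewrite eqb0 negbK => j u v j'; have [_ ncl nE _] := clusteredP bcl.
rewrite /ladj; case: (joins_eq j j') => -[<- <-]; rewrite bcl ncl nE eqxx /= !andbF //.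
Qed.

End Usage.

(** * Forms for all crossing rows of a component *)

Section CrossingForms.
Variables (n m : nat) (ends : 'I_m -> 'I_n * 'I_n).
Hypothesis simple : simple_graph ends.
Variable C : {set 'I_n}.
Hypothesis closedC : forall u v, adj ends u v -> u \in C -> v \in C.
Hypothesis connC : forall x y, x \in C -> y \in C -> connect (adj ends) x y.
Variable A : {set 'I_n}.
Hypothesis spA : splitting ends C A.

Local Notation B := (C :\: A).
Local Notation nb := (nbA ends A).
Local Notation cl := (clustered ends C A).
Local Notation od := (odds ends C A).
Local Notation J := (joins ends).

(** A crossing edge is used at most twice by triangles or by doubled pairs and leftovers, according
    to its end in [B], and at most twice by routes. Completing the open route costs one more use at
    [h]. *)
Lemma crossing_forms x0 : x0 \in C -> exists h (Ms : seq {ffun 'I_m -> int}),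
  [/\ forall M v, M \in Ms -> v \notin A -> bd ends M v = 0,
      pm (ecol ends) (map (bd ends) Ms) (crossing ends C A) != 0,
      forall e, e \in rows ends B -> (usage Ms e <= 3)%N,
      forall e, e \in crossing ends C A -> (usage Ms e <= 4 + (endB ends A e == h))%N &
      forall e, (0 < usage Ms e)%N -> e \in rows ends C].
Proof.
move=> x0C; have [h [Cl [L [perm_od va [sL Lh] use1 useL]]]] := routing simple closedC connC spA x0C.
have uq : uniq (map (@org n m) Cl ++ map (@pos n m) Cl).
  have : uniq (enum od) by apply: enum_uniq.
  by rewrite -(perm_uniq perm_od) catA cat_uniq => /andP[].
have memod s : s \in map (@org n m) Cl ++ map (@pos n m) Cl ++ map (@org n m) L -> s \in od.
  by rewrite (perm_mem perm_od) mem_enum.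
have Clod t : t \in Cl -> org t \in od /\ pos t \in od.
  by move=> tC; split; apply: memod; rewrite !mem_cat ?(map_f (@pos n m) tC) ?(map_f (@org n m) tC) ?orbT.
have Lod t : t \in L -> org t \in od.
  by move=> tL; apply: memod; rewrite !mem_cat (map_f (@org n m) tL) !orbT.
have [lo [lo_nb lo_ne]] := leftovers spA uq Clod.
(* The open route is completed at a neighbour of the hub other than the leftover of its origin; the
   default [h] never occurs. *)
pose ah (t : item n m) := odflt h [pick a in nb h :\ lo (org t)].
have ahP t : t \in L -> ah t \in nb h /\ ah t != lo (org t).
  case/Lh=> _ hB hn; rewrite /ah; case: pickP => [a /setD1P[//]|no].
  have : (0 < #|nb h :\ lo (org t)|)%N.
    move: hn; rewrite (cardsD1 (lo (org t))); case: (lo (org t) \in nb h) => //=.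
    by rewrite add0n => /ltnW.
  by case/card_gt0P=> a; rewrite no.
pose X := sqs ends C A lo.
have XP x : x \in X -> [/\ x.1 \in B, x.2.1 \in nb x.1, x.2.2 \in nb x.1 & x.2.1 != x.2.2].
  case/allpairsPdep=> b [q [bB /[dup] /pairup_mem[q1 q2] qp ->]] /=.
  rewrite mem_enum in bB; have /setDP[bB' _] := bB; split=> //; last exact: (pairup_neq (enum_uniq _) qp).
    by move: q1; rewrite mem_enum /nbE; case: ifP => // _ /setD1P[].
  by move: q2; rewrite mem_enum /nbE; case: ifP => // _ /setD1P[].
pose cform t := conn ends t (lo (org t)) (lo (pos t)).
pose lform t := conn ends t (lo (org t)) (ah t).
pose cpair (t : item n m) := (lo (org t), lo (pos t), t.2.1).
pose lpair (t : item n m) := (lo (org t), ah t, t.2.1).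
pose P := map (sqform ends) X ++ map cform Cl.
(* [P] occurs twice to give squares; an open route occurs once, as in [bprod_sqr_lin]. *)
pose Ms := map (tri ends C A) (enum cl) ++ P ++ P ++ map lform L.
pose ps := map (fun x : 'I_n * ('I_n * 'I_n) => (x.2, -1 : int)) X ++ map cpair Cl.
pose qs := map lpair L.
have vCl t : t \in Cl -> valid ends t by move=> tC; rewrite (allP va) // mem_cat tC.
have vL t : t \in L -> valid ends t by move=> tC; rewrite (allP va) // mem_cat tC orbT.
have adlo s : s \in od -> adj ends s (lo s) by move/lo_nb/nb_adj.
have bdMs : map (bd ends) Ms = map (fun a => vx a *~ 2) (map (apex ends A) (enum cl)) ++
    map (@pvec n) ps ++ map (@pvec n) ps ++ map (@pvec n) qs.
  have bdP : map (bd ends) P = map (@pvec n) ps.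
    rewrite !map_cat -!map_comp; congr (_ ++ _); apply/eq_in_map => x xX /=.
      by have [_ /nb_adj a1 /nb_adj a2 _] := XP _ xX; rewrite bd_sqform.
    by have [o p] := Clod _ xX; rewrite bd_conn //; auto.
  rewrite /Ms (map_cat _ (map _ _) (P ++ _)) (map_cat _ P (P ++ _)) (map_cat _ P (map _ _)) !bdP.
  rewrite -[map (bd ends) (map lform L)]map_comp -map_comp -[map _ qs]map_comp -[in RHS]map_comp.
  congr (_ ++ (_ ++ (_ ++ _))).
    by apply/eq_in_map => b; rewrite mem_enum => bcl /=; rewrite (bd_tri simple spA).
  apply/eq_in_map => t tL /=; have [pE _ _] := Lh _ tL; have [/nb_adj ah1 _] := ahP _ tL.
  by rewrite bd_conn //; [exact: vL|exact/adlo/Lod|rewrite pE].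
have gd p : p \in ps ++ qs -> [/\ p.1.1 \in A, p.1.2 \in A & good p].
  have e2 t : valid ends t -> t.2.1 ^+ 2 == 1 by case/andP.
  rewrite mem_cat => /orP[|/mapP[t tL ->]].
    rewrite mem_cat => /orP[/mapP[x /XP[_ /nbP[a1 _] /nbP[a2 _] ne] ->]|/mapP[t tC ->]].
      by rewrite /good /= ne.
    have [/lo_nb/nbP[o _] /lo_nb/nbP[p' _]] := Clod _ tC.
    by rewrite /good /= lo_ne // e2 // vCl.
  have [/nbP[a1 _] ne] := ahP _ tL; have /lo_nb/nbP[o _] := Lod _ tL.
  by rewrite /good /= [lo _ == _]eq_sym ne e2 // vL.
have useMs e : (usage Ms e <= uT ends C A e + 2 * uN ends C A e + 2 * itemuse (Cl ++ L) e +
    \sum_(t <- L) J e (pos t) (ah t))%N.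
  have iuE (r : seq (item n m)) : itemuse r e = (\sum_(t <- r) (t.2.2 e != 0)%R)%N.
    by rewrite /itemuse -sum1_count big_mkcond; apply: eq_bigr => t _; case: (_ != 0).
  have -> : uN ends C A e = (\sum_(x <- X) (J e x.1 x.2.1 + J e x.1 x.2.2) +
      (\sum_(t <- Cl) (J e (org t) (lo (org t)) + J e (pos t) (lo (pos t))) +
       \sum_(t <- L) J e (org t) (lo (org t))))%N.
    exact: (pairs_big lo_nb perm_od _ (fun b a => J e b a : nat)).
  rewrite usage_sum /Ms /P !big_cat !big_map /= iuE big_cat /=.
  have b1 : (\sum_(b <- enum cl) (tri ends C A b e != 0)%R <= uT ends C A e)%N.
    by rewrite big_enum; apply: leq_sum => b _; apply: tri_use.
  have b2 : (\sum_(x <- X) (sqform ends x e != 0)%R <= \sum_(x <- X) (J e x.1 x.2.1 + J e x.1 x.2.2))%N.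
    by apply: leq_sum => x _; apply: sqform_use.
  have b3 : (\sum_(t <- Cl) (cform t e != 0)%R <=
      \sum_(t <- Cl) (J e (org t) (lo (org t)) + J e (pos t) (lo (pos t))) +
      \sum_(t <- Cl) (t.2.2 e != 0)%R)%N.
    by rewrite -big_split; apply: leq_sum => t _; apply: conn_use.
  have b4 : (\sum_(t <- L) (lform t e != 0)%R <=
      \sum_(t <- L) J e (org t) (lo (org t)) + \sum_(t <- L) J e (pos t) (ah t) +
      \sum_(t <- L) (t.2.2 e != 0)%R)%N.
    by rewrite -!big_split; apply: leq_sum => t _; apply: conn_use.
  move: b1 b2 b3 b4; clear.
  move: (\sum_(t <- L) J e (org t) _)%N (\sum_(t <- L) J e (pos t) _)%N.
  move: (\sum_(t <- Cl) (_ + _))%N (\sum_(x <- X) (J _ _ _ + _))%N (uT _ _ _ _).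
  move: (\sum_(t <- L) _)%N (\sum_(t <- Cl) _)%N (\sum_(x <- X) _)%N (\sum_(b <- enum cl) _)%N.
  move: (\sum_(t <- L) _)%N (\sum_(t <- Cl) _)%N.
  lia.
have clB' : cl \subset B by apply/subsetP => b /clB.
exists h, Ms; split.
- move=> M v MMs vA; have : bd ends M \in map (bd ends) Ms by apply: map_f.
  have pA p : p \in ps ++ qs -> pvec p v = 0.
    case/gd=> p1 p2 _; rewrite !ffunE ffunMzE ffunE.
    have /negPf -> : v != p.1.1 by apply: contraNneq vA => ->.
    have /negPf -> : v != p.1.2 by apply: contraNneq vA => ->.
    by rewrite mul0rz.
  rewrite bdMs !mem_cat => /or4P[] /mapP[p pp ->]; try by apply: pA; rewrite mem_cat pp ?orbT.
  case/mapP: pp => b; rewrite mem_enum => bcl ->; have /nbP[aA _] := apex_nb spA bcl.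
  by rewrite ffunMzE ffunE; case: eqP => [E|_]; rewrite ?mul0rz // E aA in vA.
- rewrite bdMs; apply: (crossing_value spA) => //.
  + by move=> a /mapP[b]; rewrite mem_enum => bcl ->; have /nbP[] := apex_nb spA bcl.
  + by rewrite size_map.
  rewrite (crossing_target simple spA) (big_setID cl) /= (setIidPr clB'); congr (_ + _)%MM.
    rewrite big_map -big_enum /= big_seq [RHS]big_seq; apply: eq_bigr => b; rewrite mem_enum => bcl.
    by have [-> _ _ _] := clusteredP spA bcl; rewrite big_set1.
  rewrite (pairs_big lo_nb perm_od) /btarget !big_cat !big_map /= -/X -addmA.
  by [].
- move=> e eB; apply: leq_trans (useMs e) _; rewrite (uN_rowsB eB) muln0 addn0.
  rewrite [X in (_ + X)%N]big_seq big1 ?addn0 => [|t tL]; last first.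
    by have [/nbP[aA _] _] := ahP _ tL; rewrite (rowsB_notA _ eB aA).
  have [le2 no] := uT_rowsB spA eB; have [u0|upos] := posnP (uT ends C A e).
    by rewrite u0 add0n; have := use1 e; lia.
  have [-> |/useL[u [v [j l]]]] := posnP (itemuse (Cl ++ L) e); first by lia.
  by rewrite (negPf (no upos _ _ j)) in l.
- move=> e ec; apply: leq_trans (useMs e) _.
  have := uN_crossing spA ec; have := uT_crossing spA ec; have := use1 e.
  have : (\sum_(t <- L) J e (pos t) (ah t) <= (endB ends A e == h))%N.
    case: L sL Lh ahP {perm_od va use1 useL memod Lod lform qs Ms bdMs gd useMs vL} => [|t [|//]] _ Lh ahP.
      by rewrite big_nil.
    rewrite big_seq1; have [-> hB _] := Lh _ (mem_head _ _).
    have [/nbP[aA _] _] := ahP _ (mem_head _ _).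
    by case: (boolP (J e h _)) => // /(joins_crossing aA hB)[-> _]; rewrite eqxx.
  case: (endB ends A e \in cl) => /=; case: (endB ends A e == h); lia.
move=> e; apply: contraLR => eC; rewrite -leqNgt; apply: leq_trans (useMs e) _.
have noJ u v : u \in C -> v \in C -> J e u v = false.
  move=> uC vC; apply/negbTE; apply: contra eC => /orP[] /andP[/eqP E1 /eqP E2];
  by rewrite inE E1 E2 uC vC.
have AC a : a \in A -> a \in C by apply: (subsetP (split_sub spA)).
have BC b : b \in B -> b \in C by case/setDP.
have -> : uT ends C A e = 0%N.
  apply: big1 => b bcl; have [_ ncl _ _] := clusteredP spA bcl; have /nbP[/AC aC _] := apex_nb spA bcl.
  by have bC := BC _ (clB bcl); have nC := BC _ (clB ncl); rewrite !noJ.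
have -> : uN ends C A e = 0%N.
  by apply: big1 => b /setDP[/BC bC _]; apply: big1 => a /nbP[/AC aC _]; rewrite noJ.
have -> : itemuse (Cl ++ L) e = 0%N.
  apply/eqP; rewrite -leqn0 leqNgt; apply/negP => /useL[u [v [j /and4P[_ uC vC _]]]].
  by rewrite noJ in j.
rewrite big_seq big1 // => t tL; have [/nbP[/AC aC _] _] := ahP _ tL.
by have [-> /BC hC _] := Lh _ tL; rewrite noJ.
Qed.

End CrossingForms.

(** * Assembling blocks and components *)

Section Assembly.
Variables (n m : nat) (ends : 'I_m -> 'I_n * 'I_n).
Hypothesis simple : simple_graph ends.
Hypothesis nc : nice ends.

Local Notation J := (joins ends).

Definition bounded_forms (W : {set 'I_n}) := exists Ms : seq {ffun 'I_m -> int},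
  [/\ forall e, (usage Ms e <= 5)%N,
      forall e, (0 < usage Ms e)%N -> e \in rows ends W &
      pm (ecol ends) (map (bd ends) Ms) (rows ends W) != 0].

Definition closed_set (W : {set 'I_n}) :=
  forall u v, adj ends u v -> u \in W -> v \in W.

Lemma usage_cat (Ms Ns : seq {ffun 'I_m -> int}) e : usage (Ms ++ Ns) e = (usage Ms e + usage Ns e)%N.
Proof. exact: count_cat. Qed.

Lemma bd_offsupport (W : {set 'I_n}) (M : {ffun 'I_m -> int}) v :
  (forall e, M e != 0 -> e \in rows ends W) -> v \notin W -> bd ends M v = 0.
Proof.
move=> sup vW; rewrite /bd sum_ffunE big1 // => e _; rewrite ffunMzE !ffunE.
have [->|/sup] := eqVneq (M e) 0; first by rewrite mulr0z.
rewrite in_set => /andP[e1 e2].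
have /negPf -> : v != (ends e).1 by apply: contraNneq vW => ->.
have /negPf -> : v != (ends e).2 by apply: contraNneq vW => ->.
by rewrite addr0 mul0rz.
Qed.

(** An edge inside [B] is used at most [3 + 2] times. A crossing edge is used at most [4] times plus
    one, for the hub or for a token but never for both, as no token lies on [h]. *)
Lemma component_forms (C : {set 'I_n}) x0 : closed_set C ->
  (forall x y, x \in C -> y \in C -> connect (adj ends) x y) -> x0 \in C ->
  bounded_forms C.
Proof.
move=> clC conC x0C; have [A spA] := splitting_exists simple clC nc.
pose B := C :\: A.
have [h [MsA [offA nzA useB useX supA]]] := crossing_forms simple clC conC spA x0C.
have [ts [es [uts tsB ces nzB]]] := token_exists_avoiding simple B h.
have apP b : b \in B -> apex ends A b \in nbA ends A b.
  move=> bB; rewrite /apex; case: pickP => [//|no].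
  by have /set0Pn[a] := split_dom spA bB; rewrite no.
have tsP b : b \in ts -> b \in B /\ b != h by move/tsB => /setD1P[].
pose de (e : 'I_m) : {ffun 'I_m -> int} := [ffun f => (f == e)%:R].
have bd_de e : bd ends (de e) = eb ends e.
  rewrite /bd (bigD1 e) //= ffunE eqxx mulr1z big1 ?addr0 // => f /negPf ne.
  by rewrite ffunE ne.
(* A token [b] becomes an edge to [A]; the added vertex vanishes on the rows inside [B]. *)
pose MsB := map (fun b => dl ends b (apex ends A b)) ts ++ map de es.
have useMsB e : usage MsB e = (\sum_(b <- ts) J e b (apex ends A b) + count_mem e es)%N.
  rewrite usage_cat; congr (_ + _)%N; rewrite /usage count_map.
    rewrite -sum1_count big_mkcond; apply: eq_bigr => b _ /=; rewrite dl_neq0; by case: (J e b _).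
  by apply: eq_count => f /=; rewrite ffunE [e == _]eq_sym; case: (f == e).
have sXC : crossing ends C A \subset rows ends C by apply: subsetDl.
have sBC : rows ends B \subset rows ends C.
  by apply/subsetP => e; rewrite !in_set => /andP[/andP[_ ->] /andP[_ ->]].
have XB : rows ends C :\: crossing ends C A = rows ends B.
  by rewrite setDDr setDv set0U; apply/setIidPr.
exists (MsA ++ MsB); split.
- move=> e; rewrite usage_cat useMsB.
  have [eC|eC] := boolP (e \in rows ends C); last first.
    have -> : usage MsA e = 0%N.
      by apply/eqP; rewrite -leqn0 leqNgt; apply: contra eC => /supA.
    have := ces e; have -> : (e \in rows ends B) = false by apply: contraNF eC => /(subsetP sBC).
    rewrite leqn0 => /eqP ->; rewrite big_seq big1 // => b /tsP[bB _].
    have /nbP[aA _] := apP _ bB; apply/eqP; rewrite eqb0; apply: contra eC => j.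
    exact: (subsetP sXC) (crossing_joins spA aA bB j).
  have [eB|eB] := boolP (e \in rows ends B).
    have := useB _ eB; have := ces e; rewrite eB /= big_seq big1 => [|b /tsP[bB _]]; first by lia.
    by have /nbP[aA _] := apP _ bB; rewrite (rowsB_notA _ eB aA).
  have eX : e \in crossing ends C A by apply/setDP.
  have := useX _ eX; have := ces e; rewrite (negPf eB).
  have : (\sum_(b <- ts) J e b (apex ends A b) <= (endB ends A e != h))%N.
    apply: (@leq_trans (endB ends A e \in ts)).
      rewrite -[X in (_ <= X)%N]count_uniq_mem // -sum1_count [leqRHS]big_mkcond /= !big_seq.
      apply: leq_sum => b /tsP[bB _]; have /nbP[aA _] := apP _ bB.
      by case: (boolP (J e b _)) => // /(joins_crossing aA bB)[-> _]; rewrite eqxx.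
    by case: (boolP (_ \in ts)) => // /tsP[_ ->].
  by case: (endB ends A e == h) => /=; lia.
- move=> e; rewrite usage_cat useMsB addn_gt0 => /orP[/supA//|].
  rewrite addn_gt0 => /orP[|ce]; last first.
    by apply: (subsetP sBC); move: (ces e) ce; case: (e \in rows ends B) => //; lia.
  rewrite lt0n sum_nat_seq_neq0 => /hasP[b /tsP[bB _]] /=; rewrite eqb0 negbK => j.
  have /nbP[aA _] := apP _ bB.
  exact: (subsetP sXC) (crossing_joins spA aA bB j).
rewrite map_cat (pm_block (Rw := crossing ends C A)) //; first last.
- move=> y i /mapP[M MA ->] iC iX; have : i \in rows ends B by rewrite -XB inE iX.
  rewrite in_set => /andP[/setDP[_ i1] /setDP[_ i2]].
  by rewrite /ecol !offA // subr0.
- exact: pm_size nzA.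
rewrite XB mulf_neq0 //.
pose lab := map inl ts ++ map inr es : seq ('I_n + 'I_m).
pose f (l : 'I_n + 'I_m) := match l with inl b => bd ends (dl ends b (apex ends A b)) | inr e => eb ends e end.
pose g (l : 'I_n + 'I_m) := match l with inl b => vx b | inr e => eb ends e end.
have -> : map (bd ends) MsB = map f lab.
  rewrite !map_cat -!map_comp; congr (_ ++ _); apply: eq_map => // e /=; exact: bd_de.
rewrite (eq_pm_map (c' := ecol ends) (g := g)) => [|[b|e] i /=]; first last.
- by [].
- rewrite mem_cat => /orP[/mapP[b' b'ts [->]]|/mapP[//]]; have [bB _] := tsP _ b'ts.
  move=> iB; have ab := apP _ bB; rewrite bd_dl //; last exact: nb_adj ab.
  have /nbP[aA _] := ab; rewrite ecolD [X in _ + X](_ : _ = 0) ?addr0 //.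
  apply: ecol_vx0; move: iB; rewrite in_set => /andP[/setDP[_ i1] /setDP[_ i2]].
  by rewrite negb_or; apply/andP; split; apply: contraTneq aA => <-.
by rewrite map_cat -!map_comp.
Qed.

(** Components are split off one by one. Their forms have disjoint supports, so permanents multiply
    and no edge is used in two components. *)
Lemma closed_forms (W : {set 'I_n}) : closed_set W -> bounded_forms W.
Proof.
have [k] := ubnP #|W|; elim: k W => [//|k IH] W; rewrite ltnS => le clW.
have [->|[x xW]] := set_0Vmem W.
  exists [::]; split=> //=; suff -> : rows ends set0 = set0 by rewrite /pm eqxx.
  by apply/setP => e; rewrite !inE.
have sym : connect_sym (adj ends) by apply: sym_connect_sym => u v; apply: adjC.
pose C := [set y | connect (adj ends) x y].
have xC : x \in C by rewrite inE connect0.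
have clC : closed_set C.
  by move=> u v uv; rewrite !inE => xu; apply: connect_trans xu (connect1 uv).
have conC y z : y \in C -> z \in C -> connect (adj ends) y z.
  by rewrite !inE sym => yx xz; apply: connect_trans yx xz.
have CW : C \subset W.
  apply/subsetP => y; rewrite inE => /connectP[p pp ->].
  by elim: p x xW pp {C xC clC conC} => [//|z p IHp] u uW /= /andP[/clW zW pp]; apply: IHp pp; apply: zW.
have clD : closed_set (W :\: C).
  move=> u v uv /setDP[uW uC]; apply/setDP; split; first exact: clW uv uW.
  by apply: contra uC => vC; apply: clC vC; rewrite adjC.
have [MC [uMC sMC nzC]] := component_forms clC conC xC.
have [|MD [uMD sMD nzD]] := IH (W :\: C) _ clD.
  by apply: leq_trans le; rewrite (cardsD1 x W) xW ltnS subset_leq_card // setDS // sub1set.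
have sCW : rows ends C \subset rows ends W.
  apply/subsetP => e; rewrite [e \in rows _ C]in_set [e \in rows _ W]in_set.
  by case/andP=> /(subsetP CW) -> /(subsetP CW) ->.
have rD : rows ends W :\: rows ends C = rows ends (W :\: C).
  apply/setP => e; rewrite !in_set negb_and.
  have ad : adj ends (ends e).1 (ends e).2 by apply/existsP; exists e; apply: joins_ends.
  have -> : connect (adj ends) x (ends e).2 = connect (adj ends) x (ends e).1.
    have h := clC _ _ ad; rewrite !inE in h; apply/idP/idP => // h2.
    by have := clC (ends e).2 (ends e).1; rewrite adjC !inE => /(_ ad h2).
  by rewrite orbb; case: (connect _ _ _).
exists (MC ++ MD); split.
- move=> e; rewrite usage_cat; have [z|/sMC eC] := posnP (usage MC e); first by rewrite z uMD.
  have -> : usage MD e = 0%N; last by rewrite addn0.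
  apply/eqP; rewrite -leqn0 leqNgt; apply/negP => /sMD; rewrite -rD => /setDP[_].
  by rewrite eC.
- move=> e; rewrite usage_cat addn_gt0 => /orP[/sMC/(subsetP sCW)//|/sMD].
  by rewrite -rD => /setDP[].
rewrite map_cat (pm_block (Rw := rows ends C)) ?rD ?mulf_neq0 //; first exact: pm_size nzC.
move=> y i /mapP[M MM ->] iW iC.
have : i \in rows ends (W :\: C) by rewrite -rD; apply/setDP.
rewrite in_set => /andP[/setDP[_ i1] /setDP[_ i2]].
have sup e : M e != 0 -> e \in rows ends C.
  by move=> Me; apply: sMC; rewrite -has_count; apply/hasP; exists M.
by rewrite /ecol !(bd_offsupport sup) // subr0.
Qed.

End Assembly.

Theorem theorem4p1 (n m : nat) (ends : 'I_m -> 'I_n * 'I_n) :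
  simple_graph ends -> nice ends -> alg_choosable_1b ends 6.
Proof.
move=> simple nc; have clT : closed_set ends setT by move=> u v; rewrite !inE.
have [Ms [us _ nz]] := closed_forms simple nc clT.
apply: (choosable_of_forms (b := 6) simple us).
by rewrite (_ : setT = rows ends setT) //; apply/setP => e; rewrite !inE.
Qed.
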